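(* Let $n\ge 2$ and $0<s<1$. Let $\Omega\subset\mathbb R^n$ be an open set, and suppose that $u\in\mathscr L_s(\mathbb R^n)\cap C^{2s+\varepsilon}_{loc}$ for some $\varepsilon>0$. If for every $x\in\Omega$ and every $0<r<\operatorname{dist}(x,\partial\Omega)$ we have $u(x)=A^{(s)}_r\star u(x)$, then $(-\Delta)^s u=0$ in $\Omega$, and moreover $u\in C^\infty(\Omega)$.
   Context: $\mathscr L_s(\mathbb R^n)$ is the space of measurable functions $u$ on $\mathbb R^n$ with $\int_{\mathbb R^n}\frac{|u(x)|}{1+|x|^{n+2s}}\,dx<\infty$. For small $\varepsilon>0$ (i.e. $0<\varepsilon<1$ small enough that the Hölder exponents below make sense), $C^{2s+\varepsilon}_{loc}$ denotes $C^{0,2s+\varepsilon}_{loc}(\mathbb R^n)$ if $0<s<\frac12$, and $C^{1,2s+\varepsilon-1}_{loc}(\mathbb R^n)$ if $\frac12\le s<1$. For $0<s<1$ and $r>0$, $$A^{(s)}_r(y)=\begin{cases}c(n,s)\,\dfrac{r^{2s}}{(|y|^2-r^2)^s\,|y|^n}, & |y|>r,\\[2mm] 0, & |y|\le r,\end{cases}\qquad c(n,s)=\frac{\sin(\pi s)\,\Gamma\left(\frac n2\right)}{\pi^{\frac n2+1}},$$ and $A^{(s)}_r\star u(x)=\int_{\mathbb R^n}A^{(s)}_r(y)\,u(x-y)\,dy$. For $u\in\mathscr L_s(\mathbb R^n)\cap C^{2s+\varepsilon}_{loc}$ the fractional Laplacean is defined pointwise by $$(-\Delta)^s u(x)=\frac{\gamma(n,s)}{2}\int_{\mathbb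 R^n}\frac{2u(x)-u(x+y)-u(x-y)}{|y|^{n+2s}}\,dy,\qquad \gamma(n,s)=\frac{s\,2^{2s}\,\Gamma\left(\frac{n+2s}{2}\right)}{\pi^{n/2}\,\Gamma(1-s)}.$$ *)

(* Defs.v *)
From HB Require Import structures.
From mathcomp Require Import all_boot all_order all_algebra.
From mathcomp Require Import all_classical all_reals all_analysis.

Set Implicit Arguments.
Unset Strict Implicit.
Unset Printing Implicit Defensive.

Import Order.TTheory GRing.Theory Num.Theory.
Import numFieldNormedType.Exports.

Local Open Scope classical_set_scope.
Local Open Scope ring_scope.

(* R^n is 'rV[R]_n. Its library topology and differential calculus come from
   the sup norm `|x|; every metric quantity below uses the Euclidean norm. *)

Definition rV_display : measure_display -> measure_display.
Proof. exact. Qed.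

(* The sigma-algebra on R^n generated by the coordinates, as the library does
   for n.-tuple; it is the Borel sigma-algebra. *)
Section measurable_rV.
Context {R : realType} {n : nat}.

Let coors : 'I_n -> 'rV[R]_n -> R := fun i x => x ord0 i.

Let rV_set0 : g_sigma_preimage coors set0.
Proof. exact: sigma_algebra0. Qed.

Let rV_setC A : g_sigma_preimage coors A -> g_sigma_preimage coors (~` A).
Proof. exact: sigma_algebraC. Qed.

Let rV_bigcup (F : (set 'rV[R]_n)^nat) :
  (forall i, g_sigma_preimage coors (F i)) ->
  g_sigma_preimage coors (\bigcup_i (F i)).
Proof. exact: sigma_algebra_bigcup. Qed.

HB.instance Definition _ :=
  @isMeasurable.Build (rV_display default_measure_display)
    'rV[R]_n (g_sigma_preimage coors) rV_set0 rV_setC rV_bigcup.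

Lemma measurable_coor (i : 'I_n) :
  measurable_fun [set: 'rV[R]_n] (fun x : 'rV[R]_n => x ord0 i).
Proof.
move=> _ Y mY; rewrite setTI; apply: sub_sigma_algebra => /=.
rewrite -bigcup_seq/=; exists i => /=; first by rewrite mem_index_enum.
by exists Y => //; rewrite setTI.
Qed.

Lemma measurable_fun_rV d (T : measurableType d) (f : T -> 'rV[R]_n) :
  (forall i, measurable_fun setT (fun t => f t ord0 i)) ->
  measurable_fun setT f.
Proof.
move=> mf _ A mA; rewrite setTI.
suff : g_sigma_preimage coors `<=` [set B | measurable (f @^-1` B)] by apply.
apply: smallest_sub.
  split => /=; first by rewrite preimage_set0.
  - by move=> B mB; rewrite setTD preimage_setC; exact: measurableC.
  - by move=> F mF; rewrite preimage_bigcup; exact: bigcup_measurable.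
rewrite -bigcup_seq/= => B [i _ [C mC <-]]; rewrite /= setTI.
by have := mf i measurableT C mC; rewrite setTI.
Qed.

End measurable_rV.

Section lebesgue_rV.
Variable R : realType.

Definition rV_cons n (p : measurableTypeR R * 'rV[R]_n) : 'rV[R]_n.+1 :=
  \row_j oapp (p.2 ord0) p.1 (unlift ord0 j).

Let rV_uncons n (v : 'rV[R]_n.+1) : measurableTypeR R * 'rV[R]_n :=
  (v ord0 ord0, \row_j v ord0 (lift ord0 j)).

Let rV_consK n : cancel (@rV_cons n) (@rV_uncons n).
Proof.
case=> x v; congr pair; first by rewrite mxE unlift_none.
by apply/rowP => j; rewrite !mxE liftK.
Qed.

Lemma measurable_rV_cons n : measurable_fun setT (@rV_cons n).
Proof.
apply: measurable_fun_rV => i; case: (unliftP ord0 i) => [j|] ->.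
- rewrite (_ : (fun _ => _) = (fun v : 'rV[R]_n => v ord0 j) \o snd).
    by apply: measurableT_comp => //; exact: measurable_coor.
  by apply/funext => p; rewrite mxE liftK.
- rewrite (_ : (fun _ => _) = fst)//.
  by apply/funext => p; rewrite mxE unlift_none.
Qed.

Let measurable_rV_uncons n : measurable_fun setT (@rV_uncons n).
Proof.
apply: (measurable_fun_pair (measurable_coor ord0)).
apply: measurable_fun_rV => j.
rewrite (_ : (fun _ => _) = (fun v : 'rV[R]_n.+1 => v ord0 (lift ord0 j))).
  exact: measurable_coor.
by apply/funext => p; rewrite /= mxE.
Qed.

Section step.
Variables (n : nat) (mu : {sigma_finite_measure set 'rV[R]_n -> \bar R}).

Definition lebesgue_rV_step : set 'rV[R]_n.+1 -> \bar R :=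
  pushforward (lebesgue_measure \x mu)%E (@rV_cons n).

Let step0 : lebesgue_rV_step set0 = 0%E.
Proof. by rewrite /lebesgue_rV_step /pushforward preimage_set0 measure0. Qed.

Let step_ge0 A : (0 <= lebesgue_rV_step A)%E.
Proof. exact: (measure_ge0 (lebesgue_measure \x mu)%E). Qed.

Let step_sigma_additive : semi_sigma_additive lebesgue_rV_step.
Proof.
have mc A : measurable A -> measurable (@rV_cons n @^-1` A).
  by move=> mA; rewrite -[X in measurable X]setTI; exact: measurable_rV_cons.
move=> F mF tF mUF; rewrite /lebesgue_rV_step /pushforward preimage_bigcup.
apply: measure_semi_sigma_additive.
- by move=> k; exact: mc.
- apply/trivIsetP => /= i j _ _ ij; rewrite -preimage_setI.
  by move/trivIsetP : tF => /(_ _ _ _ _ ij) ->//; rewrite preimage_set0.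
- by rewrite -preimage_bigcup; exact: mc.
Qed.

HB.instance Definition _ := isMeasure.Build _ _ _
  lebesgue_rV_step step0 step_ge0 step_sigma_additive.

Let step_sigma_finite : sigma_finite setT lebesgue_rV_step.
Proof.
have /sigma_finiteP[F [TF ndF Foo]] := sigma_finiteT (@lebesgue_measure R).
have /sigma_finiteP[G [TG ndG Goo]] := sigma_finiteT mu.
exists (fun k => @rV_uncons n @^-1` (F k `*` G k)).
  rewrite -preimage_bigcup -[LHS](@preimage_setT _ _ (@rV_uncons n)).
  congr (_ @^-1` _); rewrite -setXTT TF TG predeqE => -[x y]; split.
    move=> [/= [a _ Fax] [b _ Gby]]; exists (maxn a b) => //; split.
    - by move: x Fax; exact/subsetPset/ndF/leq_maxl.
    - by move: y Gby; exact/subsetPset/ndG/leq_maxr.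
  by move=> [a _ []/= ? ?]; split; exists a.
move=> k; have [mFk Fk] := Foo k; have [mGk Gk] := Goo k; split.
  rewrite -[X in measurable X]setTI.
  by apply: measurable_rV_uncons => //; exact: measurableX.
rewrite /lebesgue_rV_step /pushforward -comp_preimage.
rewrite (_ : _ \o _ = id) ?preimage_id.
  by rewrite product_measure1E// lte_mul_pinfty// ge0_fin_numE.
by apply/funext => p /=; exact: rV_consK.
Qed.

HB.instance Definition _ := Measure_isSigmaFinite.Build _ _ _
  lebesgue_rV_step step_sigma_finite.

End step.

Fixpoint lebesgue_rV n : {sigma_finite_measure set 'rV[R]_n -> \bar R} :=
  match n with
  | 0 => dirac (0 : 'rV[R]_0)
  | n'.+1 => lebesgue_rV_step (lebesgue_rV n')
  end.

(* lebesgue_rV has the value of Lebesgue measure on measurable boxes, which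
   characterizes it among sigma-finite measures *)
Lemma lebesgue_rV_box n (A : 'I_n -> set (measurableTypeR R)) :
  (forall i, measurable (A i)) ->
  (lebesgue_rV n [set x : 'rV[R]_n | forall i, A i (x ord0 i)] =
   \prod_(i < n) lebesgue_measure (A i))%E.
Proof.
elim: n A => [|n IH] A mA.
  rewrite big_ord0 /= diracE; case: (boolP (_ \in _)) => //.
  by move/negP; elim; rewrite inE => -[].
rewrite big_ord_recl -IH; last by move=> i; exact: mA.
rewrite /= /lebesgue_rV_step /pushforward -product_measure1E //; last first.
  have -> : [set x : 'rV[R]_n | forall i, A (lift ord0 i) (x ord0 i)] =
      \bigcap_(i in [set: 'I_n])
        ((fun x : 'rV[R]_n => x ord0 i) @^-1` A (lift ord0 i)).
    by apply/seteqP; split => x /= h i; [move=> _; exact: h|exact: (h i I)].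
  apply: fin_bigcap_measurable => // i _.
  rewrite -[X in measurable X]setTI.
  by apply: measurable_coor => //; exact: mA.
congr ((_ \x _)%E _); apply/seteqP; split => -[x v] /=.
  move=> h; split=> [|i]; first by have := h ord0; rewrite mxE unlift_none.
  by have := h (lift ord0 i); rewrite mxE liftK.
move=> -[h0 h] i; case: (unliftP ord0 i) => [j|] ->; rewrite mxE.
  by rewrite liftK /=; exact: h.
by rewrite unlift_none.
Qed.

End lebesgue_rV.

Section euclidean.
Variables (R : realType) (n : nat).
Implicit Types (x y : 'rV[R]_n) (A : set 'rV[R]_n) (u : 'rV[R]_n -> R).

Definition enorm x : R := Num.sqrt (\sum_(i < n) x ord0 i ^+ 2).

Definition boundary A : set 'rV[R]_n := closure A `\` interior A.

(* the infimum of the empty set is +oo, so the distance to the empty boundary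
   of the whole space is infinite *)
Definition edist_set x A : \bar R := ereal_inf [set (enorm (x - z))%:E | z in A].

Definition partial (i : 'I_n) u : 'rV[R]_n -> R :=
  fun x => 'D_(delta_mx ord0 i : 'rV[R]_n) u x.

Definition partials (l : seq 'I_n) u : 'rV[R]_n -> R := foldr partial u l.

(* C^oo(Omega), for an open Omega *)
Definition smooth_on A u : Prop :=
  forall (l : seq 'I_n) x, A x ->
    {for x, continuous (partials l u)} /\
    forall i : 'I_n, derivable (partials l u) x (delta_mx ord0 i : 'rV[R]_n).

(* C^{0,alpha}_loc(R^n) *)
Definition holder_loc (alpha : R) u : Prop :=
  forall K : set 'rV[R]_n, compact K ->
    exists C : R, forall x y, K x -> K y ->
      `|u x - u y| <= C * enorm (x - y) `^ alpha.

(* C^{1,alpha}_loc(R^n); for alpha > 0 the Hölder condition includes the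
   continuity of the partial derivatives *)
Definition holder1_loc (alpha : R) u : Prop :=
  forall i : 'I_n,
    (forall x, derivable u x (delta_mx ord0 i : 'rV[R]_n)) /\
    holder_loc alpha (partial i u).

(* eps is small when the Hölder exponent of C^{2s+eps}_loc lies in ]0, 1] *)
Definition small_eps (s eps : R) : Prop :=
  0 < eps < 1 /\
  (if s < 2^-1 then 2 * s + eps <= 1 else 2 * s + eps - 1 <= 1).

Definition C2s_loc (s eps : R) u : Prop :=
  if s < 2^-1 then holder_loc (2 * s + eps) u
  else holder1_loc (2 * s + eps - 1) u.

Definition Ls (s : R) u : Prop :=
  measurable_fun setT u /\
  (\int[lebesgue_rV R n]_x
     (`|u x| / (1 + enorm x `^ (n%:R + 2 * s)))%:E < +oo)%E.

End euclidean.

(* Euler's integral, used only for x > 0 *)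
Definition Gamma (R : realType) (x : R) : R :=
  \int[lebesgue_measure]_(t in `]0, +oo[) (t `^ (x - 1) * expR (- t)).

Section fractional_laplacian.
Variables (R : realType) (n : nat) (s : R).
Implicit Types (x y : 'rV[R]_n) (u : 'rV[R]_n -> R).

Definition c_ns : R :=
  sin (pi * s) * Gamma (n%:R / 2) / pi `^ (n%:R / 2 + 1).

Definition gamma_ns : R :=
  s * 2 `^ (2 * s) * Gamma ((n%:R + 2 * s) / 2) /
  (pi `^ (n%:R / 2) * Gamma (1 - s)).

Definition A_kernel (r : R) y : R :=
  if r < enorm y then
    c_ns * (r `^ (2 * s) / ((enorm y ^+ 2 - r ^+ 2) `^ s * enorm y ^+ n))
  else 0.

(* Both operators take values in \bar R: the extended Lebesgue integral is
   finite only if the integrand is integrable, so an equation with a finite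
   value also asserts convergence. *)
Definition A_star (r : R) u x : \bar R :=
  (\int[lebesgue_rV R n]_y (A_kernel r y * u (x - y))%:E)%E.

(* the integrand is 0 at y = 0, where the denominator vanishes *)
Definition frac_laplacian u x : \bar R :=
  ((gamma_ns / 2)%:E *
   \int[lebesgue_rV R n]_y
     ((2 * u x - u (x + y) - u (x - y)) /
      enorm y `^ (n%:R + 2 * s))%:E)%E.

End fractional_laplacian.

(* Main.v *)
Require Import Defs.
From mathcomp Require Import all_boot all_order all_algebra.
From mathcomp Require Import all_classical all_reals all_analysis.
From mathcomp Require Import measurable_realfun lebesgue_integral_under ring lra.
Import Order.TTheory GRing.Theory Num.Theory.
Import numFieldNormedType.Exports.
Local Open Scope classical_set_scope.
Local Open Scope ring_scope.
Set Implicit Arguments.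
Unset Strict Implicit.

(* The kernels A_r are averaged over r.  With t = r^2, a smooth bump psi
   supported in ]1, 2[ and m = n/2 + s - 1, the mean value property integrated
   against psi (th t) t^(n/2 - 1) dt becomes, by Fubini,
     u(x) V(th) = int G(th |y|^2) u(x - y) dy,
     G(q) = int_0^1 psi(q t) t^m (1 - t)^-s dt,
   where V(th) = const th^-(n/2).  The function G is smooth, vanishes near 0, and
   its j-th derivative is O(q^-(m + 1 + j)), so y |-> G(th |y|^2) has all its
   partial derivatives bounded by (1 + |y|^(n + 2 s))^-1: near each point of Omega
   u is the convolution of such a kernel with a function of L_s, hence smooth.
   For the fractional Laplacian, multiply
     int G(th |y|^2) (2 u(x) - u(x + y) - u(x - y)) dy = D(x) th^-(n/2)
   by th^(m + 1) and let th tend to infinity.  The left-hand side tends to a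
   nonzero multiple of int (2 u(x) - u(x + y) - u(x - y)) / |y|^(n + 2 s) dy, and
   the right-hand side is D(x) th^s; hence D(x) = 0 and the integral vanishes.
   That A_r has total mass 1 is never needed. *)

(** * Affine changes of variables *)

(** The obstacle is the sphere |y| = r. The kernel blows up there like (|y| - r)^-s, so a derivative
    moved onto it is no longer integrable. Averaging over r alone leaves a singularity at an end
    point that moves with |y|. The substitution t -> q t, with q = |y|^2, pins it at t = 1 and
    leaves q only inside the bump, so every derivative falls on the bump. The density t^(n/2 - 1)
    makes the powers match: the substitution produces q^(n/2) = |y|^n, which cancels the factor
    |y|^-n of the kernel, and 2 (m + 1) = n + 2 s is the exponent of the L_s weight and of the
    fractional Laplacian alike.

    D(x) is 2 u(x) times the gap between the integral of G(|y|^2) and the value that mass 1 would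
    give it. It is never evaluated, so c(n, s) enters only as a positive number.

    In the passage to the limit the majorant comes from the Hölder condition near y = 0 and from L_s
    at infinity. Integrals of powers of |y| come from dilations instead of polar coordinates, and
    inductively defined classes stable under differentiation replace formulas for higher
    derivatives. *)

Section affine.
Context {R : realType}.
Implicit Types (k b : R).
Local Notation mu := (@lebesgue_measure R).

Lemma measurable_affine k b :
  measurable_fun setT
    (fun x : measurableTypeR R => k * x + b : measurableTypeR R).
Proof. by apply: measurable_funD => //; apply: measurable_funM. Qed.

(** Lebesgue measure is determined by its values on the intervals []c, d]], whose preimages are
    intervals with length divided by |k|. *)
Lemma lebesgue_measure_affine k b A : k != 0 -> measurable A ->
  mu A = (`|k|%R%:E * pushforward mu (fun x : R => (k * x + b)%R :
    measurableTypeR R) A)%E.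
Proof.
move=> k0 mA.
have := @lebesgue_measure_unique R (mscale `|k|%:nng
  (pushforward mu (fun x : R => k * x + b : measurableTypeR R))) _ A mA.
apply; first exact: measurable_affine.
move=> ? _ [[c d] _ <-].
change (mu `]c, d] = (`|k|%R%:E * mu ((fun x : R => (k * x + b)%R) @^-1` `]c, d]))%E).
have [kgt0|klt0] : k > 0 \/ k < 0 by case: ltgtP k0 => //; auto.
- rewrite [X in (_ * mu X)%E](_ : _ = `](c - b) / k, (d - b) / k]%classic); last first.
    apply/seteqP; split => x /=; rewrite !in_itv/= ltr_pdivrMr// ler_pdivlMr// ltrBlDr
      lerBrDr (mulrC x) //.
  rewrite !lebesgue_measure_itv/= !lte_fin.
  rewrite ltr_pM2r ?invr_gt0// ltrD2r; case: ifPn => cd; last by rewrite mule0.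
  by rewrite gtr0_norm// -EFinM; congr EFin; field.
(* A negative slope exchanges the ends, so the preimage is closed on the left; its length is
   unaffected. *)
- rewrite [X in (_ * mu X)%E](_ : _ = `[(d - b) / k, (c - b) / k[%classic); last first.
    apply/seteqP; split => x /=; rewrite !in_itv/= ltr_ndivlMr// ler_ndivrMr// ltrBlDr
      lerBrDr (mulrC x) andbC //.
  rewrite !lebesgue_measure_itv/= !lte_fin.
  rewrite ltr_nM2r ?invr_lt0// ltrD2r; case: ifPn => cd; last by rewrite mule0.
  by rewrite ltr0_norm// -EFinM; congr EFin; field.
Qed.

Lemma ge0_integral_affine k b (f : measurableTypeR R -> \bar R) : k != 0 ->
  measurable_fun setT f -> (forall x, 0 <= f x)%E ->
  (\int[mu]_x f (k * x + b)%R = (`|k|^-1)%R%:E * \int[mu]_x f x)%E.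
Proof.
move=> k0 mf f0.
rewrite [X in (_ * X)%E](@eq_measure_integral _ _ _ _ (mscale `|k|%:nng
  (pushforward mu (fun x : R => (k * x + b)%R : measurableTypeR R))));
  [exact: measurable_affine|move=> ?|
   by move=> ? A mA _; rewrite -[LHS]/(mu A) (lebesgue_measure_affine b k0 mA)].
rewrite ge0_integral_mscale//= (ge0_integral_pushforward (measurable_affine k b)
  lebesgue_measure measurableT mf)//=.
by rewrite muleA -EFinM mulVf ?normr_eq0// mul1e.
Qed.

End affine.

Section affine_rV.
Context {R : realType}.
Local Open Scope ereal_scope.

Lemma ge0_integral_rV_step n (f : 'rV[R]_n.+1 -> \bar R) :
  measurable_fun setT f -> (forall x, 0 <= f x) ->
  \int[lebesgue_rV R n.+1]_x f x =
  \int[lebesgue_measure]_x \int[lebesgue_rV R n]_v f (rV_cons (x, v)).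
Proof.
move=> mf f0.
rewrite [LHS](@ge0_integral_pushforward _ _ _ _ _ _ (@measurable_rV_cons R n)
   (lebesgue_measure \x lebesgue_rV R n))//=.
rewrite fubini_tonelli1//=.
by apply: measurableT_comp => //; exact: measurable_rV_cons.
Qed.

Lemma measurable_affine_rV n (k : R) (b : 'rV[R]_n) :
  measurable_fun setT (fun x : 'rV[R]_n => k *: x + b)%R.
Proof.
apply: measurable_fun_rV => i.
rewrite (_ : (fun _ => _) = fun x : 'rV[R]_n => k * x ord0 i + b ord0 i)%R; last first.
  by apply/funext => x; rewrite !mxE.
by apply: measurable_funD => //; apply: measurable_funM => //; exact: measurable_coor.
Qed.

(** By Tonelli, each coordinate contributes one factor 1/|k|; the induction peels off the first
    coordinate. *)
Lemma ge0_integral_affine_rV n (k : R) (b : 'rV[R]_n) (f : 'rV[R]_n -> \bar R) :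
  k != 0%R -> measurable_fun setT f -> (forall x, 0 <= f x) ->
  \int[lebesgue_rV R n]_x f (k *: x + b)%R =
    (`|k|%R ^- n)%:E * \int[lebesgue_rV R n]_x f x.
Proof.
move=> k0; elim: n b f => [|n IH] b f mf f0.
  rewrite expr0 invr1 mul1e; apply: eq_integral => x _.
  by congr f; apply/rowP => -[].
rewrite ge0_integral_rV_step//; last first.
  by apply: measurableT_comp => //; exact: measurable_affine_rV.
rewrite ge0_integral_rV_step//.
pose b' : 'rV[R]_n := \row_j b ord0 (lift ord0 j).
pose h x := \int[lebesgue_rV R n]_v f (rV_cons (x, v)).
have mfc : measurable_fun setT (fun p : measurableTypeR R * 'rV[R]_n => f (rV_cons p)).
  by apply: measurableT_comp => //; exact: measurable_rV_cons.
have mh : measurable_fun setT h.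
  exact: (measurable_fun_fubini_tonelli_F _ mfc).
transitivity (\int[lebesgue_measure]_x ((`|k|%R ^- n)%:E * h (k * x + b ord0 ord0)%R)).
  apply: eq_integral => x _; rewrite /h -(IH b')//; last first.
    exact: (measurable_fun_pair2 _ mfc).
  apply: eq_integral => v _; congr f.
  apply/rowP => i; rewrite !mxE; case: (unliftP ord0 i) => [j|] -> /=.
    by rewrite ?liftK /= ?mxE ?liftK /= ?mxE.
  by rewrite ?unlift_none.
have mhk := measurableT_comp mh (measurable_affine k (b ord0 ord0)).
have h0 x : 0 <= h x by apply: integral_ge0.
rewrite ge0_integralZl//=.
rewrite ge0_integral_affine//.
by rewrite muleA -EFinM -invfM -exprSr.
Qed.

End affine_rV.

(** * Integrals of powers of the Euclidean norm *)

Section enorm.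
Context {R : realType} {n : nat}.
Implicit Types x y z : 'rV[R]_n.

Lemma enorm_ge0 x : 0 <= enorm x. Proof. exact: sqrtr_ge0. Qed.

Lemma sqr_enorm x : enorm x ^+ 2 = \sum_(i < n) x ord0 i ^+ 2.
Proof. by rewrite sqr_sqrtr// sumr_ge0// => i _; rewrite sqr_ge0. Qed.

Lemma enormZ (k : R) x : enorm (k *: x) = `|k| * enorm x.
Proof.
rewrite /enorm; under eq_bigr do rewrite mxE exprMn.
by rewrite -mulr_sumr sqrtrM ?sqr_ge0// sqrtr_sqr.
Qed.

Lemma enormN x : enorm (- x) = enorm x.
Proof. by rewrite -scaleN1r enormZ normrN1 mul1r. Qed.

Lemma enorm0 : enorm (0 : 'rV[R]_n) = 0.
Proof. by rewrite -(scale0r 0) enormZ normr0 mul0r. Qed.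

Lemma coord_le_enorm x i : `|x ord0 i| <= enorm x.
Proof.
rewrite -sqrtr_sqr ler_wsqrtr// (bigD1 i)//= lerDl sumr_ge0// => j _.
by rewrite sqr_ge0.
Qed.

Lemma norm_le_coord x (M : R) : 0 <= M -> (forall i, `|x ord0 i| <= M) -> `|x| <= M.
Proof.
move=> M0 xM; rewrite [leLHS](mx_normE x) -[M]/(NngNum M0)%:num num_le.
by apply/bigmax_leP; split=> [|[i j] _]; rewrite -num_le//= ord1.
Qed.

Lemma norm_le_enorm x : `|x| <= enorm x.
Proof. by apply: norm_le_coord (enorm_ge0 x) _ => i; exact: coord_le_enorm. Qed.

Lemma enorm_eq0 x : (enorm x == 0) = (x == 0).
Proof.
apply/idP/idP => [/eqP x0|/eqP->]; last by rewrite enorm0.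
by rewrite -normr_le0 -x0 norm_le_enorm.
Qed.

Lemma coord_le_norm x i : `|x ord0 i| <= `|x|.
Proof.
rewrite [leRHS](mx_normE x).
have : (`|x ord0 i|%:nng <= \big[Order.max/0%:nng]_j `|x j.1 j.2|%:nng :> {nonneg R})%O.
  by apply/bigmax_geP; right; exists (ord0, i).
by rewrite -num_le.
Qed.

Lemma enorm_le_norm x : enorm x <= n%:R * `|x|.
Proof.
rewrite -[leRHS]ger0_norm ?mulr_ge0// -sqrtr_sqr ler_wsqrtr//.
rewrite exprMn.
apply: (@le_trans _ _ (n%:R * `|x| ^+ 2)).
  rewrite mulr_natl -[X in _ *+ X]card_ord -sumr_const.
  apply: ler_sum => i _.
  by rewrite -real_normK ?num_real// ler_sqr ?nnegrE// coord_le_norm.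
rewrite ler_wpM2r ?sqr_ge0// -natrX ler_nat expnS expn1.
by case: (n) => // m; rewrite leq_pmull.
Qed.

(** A crude triangle inequality through the sup norm. It serves only in estimates with free
    constants, where the factor n is harmless. *)
Lemma enormD_le x y : enorm (x + y) <= n%:R * (enorm x + enorm y).
Proof.
apply: (le_trans (enorm_le_norm _)); rewrite ler_wpM2l//.
by rewrite (le_trans (ler_normD _ _))// lerD// norm_le_enorm.
Qed.

Lemma measurable_enorm : measurable_fun setT (@enorm R n).
Proof.
apply: (measurableT_comp (continuous_measurable_fun (@sqrt_continuous R))).
apply: measurable_sum => i; apply: measurable_funX; exact: measurable_coor.
Qed.

End enorm.

Lemma powRD_le (R : realType) (p a b : R) : 0 <= p -> 0 <= a -> 0 <= b ->
  (a + b) `^ p <= 2 `^ p * (a `^ p + b `^ p).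
Proof.
move=> p0; wlog ab : a b / a <= b => [h a0 b0|a0 b0].
  by have [/h|/ltW/h] := leP a b; rewrite 1?(addrC a) ?(addrC (a `^ p)); apply.
apply: (@le_trans _ _ ((2 * b) `^ p)).
  by apply: ge0_ler_powR; rewrite ?nnegrE ?addr_ge0 ?mulr_ge0//; lra.
by rewrite powRM// ler_wpM2l ?powR_ge0// lerDr powR_ge0.
Qed.

(** This is what makes the majorants of a convolution uniform for x in a bounded set. *)
Lemma weight_translate (R : realType) n (p M : R) : 0 <= p -> 0 <= M ->
  exists2 C, 0 < C & forall x z : 'rV[R]_n, enorm x <= M ->
    1 + enorm z `^ p <= C * (1 + enorm (x - z) `^ p).
Proof.
move=> p0 M0; pose N := (n%:R : R) `^ p * 2 `^ p.
have N0 : 0 <= N by rewrite mulr_ge0 ?powR_ge0.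
exists (1 + N + N * M `^ p) => [|x z xM].
  by rewrite -addrA ltr_wpDr// addr_ge0// mulr_ge0// powR_ge0.
have : enorm z `^ p <= N * (M `^ p + enorm (x - z) `^ p).
  rewrite -mulrA; apply: (@le_trans _ _ ((n%:R * (M + enorm (x - z))) `^ p)).
    apply: ge0_ler_powR; rewrite ?nnegrE ?mulr_ge0 ?addr_ge0 ?enorm_ge0//.
    rewrite -[X in enorm X <= _](subKr x) (le_trans (enormD_le _ _))//.
    by rewrite enormN ler_wpM2l// lerD2r.
  rewrite powRM ?addr_ge0 ?enorm_ge0// ler_wpM2l ?powR_ge0//.
  by rewrite powRD_le// enorm_ge0.
have := powR_ge0 (enorm (x - z)) p; have := powR_ge0 M p.
set a := M `^ p; set b := enorm (x - z) `^ p => a0 b0 h.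
apply: (le_trans (lerD (lexx 1) h)).
(* The constant is tailored so that the difference of the two sides expands into nonnegative
   terms. *)
rewrite -subr_ge0.
have -> : (1 + N + N * a) * (1 + b) - (1 + N * (a + b)) = N + b + N * (a * b) by ring.
by rewrite !addr_ge0// !mulr_ge0.
Qed.

Lemma measurable_scale_rV (R : realType) n (k : R) :
  measurable_fun setT (fun x : 'rV[R]_n => k *: x).
Proof.
rewrite (_ : (fun _ => _) = fun x : 'rV[R]_n => k *: x + 0).
  exact: measurable_affine_rV.
by apply/funext => x; rewrite addr0.
Qed.

Section integral_geometric.
Local Open Scope ereal_scope.
Context {R : realType} {n : nat}.

(* A self-similar bound [F y <= g y + rho * F (l * y)] with [rho < l ^+ n] is
   integrated over the exhaustion [D k], where the integral of F is finite and
   can be absorbed. *)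
Lemma integral_geometric (F g : 'rV[R]_n -> R) (D : nat -> set 'rV[R]_n) (l rho : R) :
  measurable_fun setT F -> (forall y, 0 <= F y)%R ->
  measurable_fun setT g -> (forall y, 0 <= g y)%R ->
  \int[lebesgue_rV R n]_y (g y)%:E < +oo ->
  (forall k, measurable (D k)) -> nondecreasing_seq D ->
  (forall y, F y != 0%R -> exists k, D k y) ->
  (forall k, \int[lebesgue_rV R n]_(y in D k) (F y)%:E < +oo) ->
  (0 < l)%R -> (0 <= rho < l ^+ n)%R ->
  (forall k y, D k y -> D k (l *: y)%R) ->
  (forall y, F y <= g y + rho * F (l *: y))%R ->
  \int[lebesgue_rV R n]_y (F y)%:E < +oo.
Proof.
move=> mF F0 mg g0 gfin mD ndD DF Ffin l0 /andP[rho0 rhol] Dl Fle.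
set mu := lebesgue_rV R n.
pose th := (rho / l ^+ n)%R.
have th1 : (th < 1)%R by rewrite ltr_pdivrMr ?exprn_gt0// mul1r.
have gf : (\int[mu]_y (g y)%:E) \is a fin_num.
  by rewrite ge0_fin_numE//; apply: integral_ge0 => y _; rewrite lee_fin.
have Dbound k : \int[mu]_(y in D k) (F y)%:E <=
    (fine (\int[mu]_y (g y)%:E) / (1 - th))%R%:E.
  pose f := (EFin \o F) \_ (D k).
  have f0 y : 0 <= f y by rewrite /f patchE; case: ifP => // _; rewrite lee_fin.
  have mf : measurable_fun setT f.
    by apply/(measurable_restrictT _ (mD k)); apply/measurable_EFinP;
      exact: measurable_funTS.
  have fle y : f y <= (g y)%:E + rho%:E * f (l *: y)%R.
    rewrite {1}/f patchE; case: ifP => [|_]; last first.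
      by rewrite adde_ge0 ?lee_fin// mule_ge0// lee_fin.
    rewrite inE => /Dl Dly.
    by rewrite /f patchE mem_set//= -EFinM -EFinD lee_fin.
  have mfl : measurable_fun setT (fun y : 'rV[R]_n => f (l *: y)%R).
    exact: measurableT_comp mf (measurable_scale_rV l).
  have Jfin : \int[mu]_y f y \is a fin_num.
    rewrite ge0_fin_numE ?integral_ge0//.
    by rewrite -[X in X < _]integral_mkcond.
  have : \int[mu]_y f y <= \int[mu]_y (g y)%:E + th%:E * \int[mu]_y f y.
    apply: (@le_trans _ _ (\int[mu]_y ((g y)%:E + rho%:E * f (l *: y)%R))).
      apply: ge0_le_integral => //.
      + apply: emeasurable_funD; first exact/measurable_EFinP.
        exact: measurable_funeM.
    rewrite ge0_integralD//; last 4 first.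
    - by move=> y _; rewrite lee_fin.
    - exact/measurable_EFinP.
    - by move=> y _; rewrite mule_ge0// lee_fin.
    - exact: measurable_funeM.
    rewrite ge0_integralZl//.
    under [X in _ + _ * X]eq_integral => y _ do rewrite -[(l *: y)%R]addr0.
    rewrite ge0_integral_affine_rV ?gt_eqF// gtr0_norm//.
    by rewrite muleA -EFinM.
  rewrite [\int[mu]_(y in D k) _]integral_mkcond -/f.
  rewrite -(fineK Jfin) -(fineK gf) -EFinM -EFinD !lee_fin => h.
  by rewrite ler_pdivlMr ?subr_gt0//; lra.
have <- : \int[mu]_(y in \bigcup_k D k) (F y)%:E = \int[mu]_y (F y)%:E.
  rewrite integral_mkcond; apply: eq_integral => y _; rewrite patchE.
  case: ifPn => // /negP yD; have [->//|/DF[k Dk]] := eqVneq (F y) 0%R.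
  by exfalso; apply: yD; rewrite inE; exists k.
have cvD : \int[mu]_(y in D i) (F y)%:E @[i --> \oo] -->
    \int[mu]_(y in \bigcup_k D k) (F y)%:E.
  apply: ge0_nondecreasing_set_cvg_integral => //.
  - by move=> i; apply/measurable_EFinP; exact: measurable_funTS.
  - by move=> i y _; rewrite lee_fin.
apply: (@le_lt_trans _ _ ((fine (\int[mu]_y (g y)%:E) / (1 - th))%R%:E));
  last by rewrite ltry.
rewrite -(cvg_lim _ cvD)//; apply: lime_le; first by apply/cvg_ex; eexists; exact: cvD.
exact: nearW.
Qed.

End integral_geometric.

(** On nonnegative reals the inverse is the power -1, even at 0 where both are 0 by convention, and
    powers are measurable. *)
Lemma measurable_funV_ge0 d (T : measurableType d) (R : realType) (f : T -> R) :
  (forall x, 0 <= f x) -> measurable_fun setT f ->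
  measurable_fun setT (fun x => (f x)^-1).
Proof.
move=> f0 mf; rewrite (_ : (fun _ => _) = fun x => f x `^ (-1)).
  exact: (measurableT_comp (measurable_powR (-1)) mf).
by apply/funext => x; rewrite powR_inv1.
Qed.

Section power_integrals.
Context {R : realType} {n : nat}.
Implicit Types (y : 'rV[R]_n) (r a : R).
Local Notation mu := (lebesgue_rV R n).

Definition eball r : set 'rV[R]_n := [set y | enorm y <= r].

Lemma measurable_eball r : measurable (eball r).
Proof.
rewrite (_ : eball r = setT `&` (@enorm R n) @^-1` `]-oo, r]%classic).
  by apply: measurable_enorm.
by rewrite setTI; apply/seteqP; split => y /=; rewrite in_itv.
Qed.

Lemma eball_fin r : (mu (eball r) < +oo)%E.
Proof.
pose A (i : 'I_n) : set (measurableTypeR R) := `[- r, r]%classic.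
apply: (@le_lt_trans _ _ (mu [set x : 'rV[R]_n | forall i, A i (x ord0 i)])).
  apply: le_measure; rewrite ?inE.
  - exact: measurable_eball.
  - have -> : [set x : 'rV[R]_n | forall i, A i (x ord0 i)] =
        \bigcap_(i in [set: 'I_n]) ((fun x : 'rV[R]_n => x ord0 i) @^-1` A i).
      by apply/seteqP; split => x /= h i; [move=> _; exact: h|exact: (h i I)].
    apply: fin_bigcap_measurable => // i _; rewrite -[X in measurable X]setTI.
    by apply: measurable_coor => //; exact: measurable_itv.
  - move=> y /= yr i; rewrite /A/= in_itv/= -ler_norml.
    exact: le_trans (coord_le_enorm _ _) yr.
rewrite lebesgue_rV_box; last by move=> i; exact: measurable_itv.
suff : (\prod_(i < n) lebesgue_measure (A i))%E \is a fin_num.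
  by rewrite fin_numElt => /andP[].
apply: (big_ind (fun x => x \is a fin_num)%E) => // [x y xf yf|i _].
  exact: fin_numM.
by rewrite lebesgue_measure_itv/=; case: ifP.
Qed.

Lemma integral_indic_eball r : (\int[mu]_y (\1_(eball r) y)%:E < +oo)%E.
Proof.
by rewrite integral_indic ?setIT ?eball_fin//; exact: measurable_eball.
Qed.

Lemma measurable_indic_eball r : measurable_fun setT (\1_(eball r) : _ -> R).
Proof. by apply: measurable_indic; exact: measurable_eball. Qed.

Lemma integralZ_indic_eball c r : 0 <= c ->
  (\int[mu]_y (c * \1_(eball r) y)%:E < +oo)%E.
Proof.
move=> c0; under eq_integral do rewrite EFinM.
rewrite ge0_integralZl//; last by apply/measurable_EFinP; exact: measurable_indic_eball.
by rewrite lte_mul_pinfty ?lee_fin// integral_indic_eball.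
Qed.

Lemma measurable_powR_enorm a : measurable_fun setT (fun y => enorm y `^ a).
Proof. exact: (measurableT_comp (measurable_powR a) measurable_enorm). Qed.

Lemma powR_decr (a x y : R) : 0 <= a -> 0 < x -> x <= y -> y `^ (- a) <= x `^ (- a).
Proof.
move=> a0 x0 xy; rewrite !powRN lef_pV2 ?posrE ?powR_gt0 ?(lt_le_trans x0)//.
by apply: ge0_ler_powR; rewrite ?nnegrE// ltW// (lt_le_trans x0).
Qed.

Lemma gt1_ltr_powR a (x y : R) : 1 < a -> x < y -> a `^ x < a `^ y.
Proof.
move=> a1 xy; rewrite /powR gt_eqF ?(lt_trans _ a1)//.
by rewrite ltr_expR ltr_pM2r// ln_gt0.
Qed.

(** Doubling: |y|^-a = 2^a |2 y|^-a controls the half ball with ratio 2^a < 2^n, and on the rest of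
    the unit ball the integrand is at most 2^a. *)
Lemma integral_enorm_near0 a : 0 < a < n%:R ->
  (\int[mu]_y (\1_(eball 1) y * enorm y `^ (- a))%:E < +oo)%E.
Proof.
move=> /andP[a0 an].
have m1 := measurable_indic_eball.
have mF : measurable_fun setT (fun y => \1_(eball 1) y * enorm y `^ (- a)).
  by apply: measurable_funM => //; exact: measurable_powR_enorm.
(* Complements of shrinking balls are stable under doubling, and the integrand is bounded on each of
   them. *)
apply: (@integral_geometric R n _ (fun y => 2 `^ a * \1_(eball 1) y)
  (fun k => ~` eball k.+1%:R^-1) 2 (2 `^ a)) => //.
- by move=> y; rewrite mulr_ge0// powR_ge0.
- by apply: measurable_funM.
- by apply: integralZ_indic_eball; exact: powR_ge0.
- by move=> k; apply: measurableC; exact: measurable_eball.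
- apply/nondecreasing_seqP => k; apply/subsetPset/subsetC => y /= /le_trans; apply.
  by rewrite lef_pV2 ?posrE// ler_nat.
(* A nonzero power of 0 is 0 by convention, so the origin may stay outside the exhaustion. *)
- move=> y; rewrite mulf_eq0 negb_or => /andP[_ y0].
  have {y0} : 0 < enorm y.
    rewrite lt_neqAle enorm_ge0 andbT eq_sym; apply: contra y0 => /eqP->.
    by rewrite powR0// oppr_eq0 gt_eqF.
  move=> y0; have [k hk] : exists k : nat, (enorm y)^-1 < k%:R.
    by exists (Num.trunc (enorm y)^-1).+1; rewrite truncnS_gt.
  exists k => /=; apply/negP; rewrite -ltNge.
  rewrite -[X in _ < X]invrK ltf_pV2 ?posrE ?invr_gt0// (lt_trans hk)//.
  by rewrite ltr_nat.
- move=> k; apply: (@le_lt_trans _ _ (\int[mu]_y (k.+1%:R^-1 `^ (- a) * \1_(eball 1)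
    y)%:E)%E).
    rewrite integral_mkcond; apply: ge0_le_integral => //.
    + by move=> y _; rewrite patchE; case: ifP => // _;
        rewrite lee_fin mulr_ge0// powR_ge0.
    + apply/(measurable_restrictT _ (measurableC (measurable_eball _))).
      by apply/measurable_EFinP; exact: measurable_funTS.
    + by apply/measurable_EFinP; apply: measurable_funM.
    + move=> y _; rewrite patchE; case: ifP => [|_]; last first.
        by rewrite lee_fin mulr_ge0// powR_ge0.
      rewrite inE /= => /negP; rewrite -ltNge => ky.
      rewrite lee_fin mulrC ler_wpM2r// powR_decr//; exact: ltW.
  by apply: integralZ_indic_eball; exact: powR_ge0.
- by rewrite powR_ge0/= -powR_mulrn// gt1_ltr_powR// ltr1n.
- move=> k y /= /negP; rewrite -ltNge => ky; apply/negP; rewrite -ltNge.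
  by rewrite enormZ ger0_norm// (lt_le_trans ky)//; have := enorm_ge0 y; lra.
- move=> y; rewrite enormZ ger0_norm// powRM ?enorm_ge0//.
  have [y1|y1] := leP (enorm y) 1; last first.
    have y1' : y \in eball 1 = false.
      by apply: memNset => /=; apply/negP; rewrite -ltNge.
    by rewrite !indicE y1' mul0r mulr0 add0r !mulr_ge0 ?powR_ge0.
  rewrite indicE mem_set// mul1r mulr1; have [y2|y2] := leP (enorm y) 2^-1.
    rewrite indicE mem_set ?mul1r; last by rewrite /eball/= enormZ ger0_norm//; lra.
    have h2 : (2 : R) `^ a * 2 `^ (- a) = 1.
      by rewrite powRN mulfV// powR_eq0 negb_and pnatr_eq0.
    by rewrite mulrA h2 mul1r lerDr powR_ge0.
  apply: (@le_trans _ _ (2 `^ a)); last by rewrite lerDl !mulr_ge0 ?powR_ge0.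
  have -> : (2 : R) `^ a = 2^-1 `^ (- a).
    by rewrite -powR_inv1// -powRrM mulN1r opprK.
  by apply: powR_decr => //; apply: ltW.
Qed.

(** Halving replaces doubling: the ratio is 2^-a < 2^-n, and the remainder, bounded by 1, is carried
    by the ball of radius 2. *)
Lemma integral_enorm_infty a : n%:R < a ->
  (\int[mu]_y (\1_(~` eball 1) y * enorm y `^ (- a))%:E < +oo)%E.
Proof.
move=> na; have a0 : 0 < a by exact: le_lt_trans na.
have m1 := measurable_indic_eball.
have mF : measurable_fun setT (fun y => \1_(~` eball 1) y * enorm y `^ (- a)).
  apply: measurable_funM => //; last exact: measurable_powR_enorm.
  by apply: measurable_indic; exact: (measurableC (measurable_eball _)).
have h2 : (2^-1 : R) `^ (- a) = 2 `^ a by rewrite -powR_inv1// -powRrM mulN1r opprK.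
have h2' : (2 : R) `^ (- a) * 2 `^ a = 1.
  by rewrite powRN mulVf// powR_eq0 negb_and pnatr_eq0.
have Fle1 y : \1_(~` eball 1) y * enorm y `^ (- a) <= 1.
  rewrite indicE; have [|_] := boolP (_ \in _); last by rewrite mul0r.
  rewrite inE /= => /negP; rewrite -ltNge mul1r => y1.
  by have := powR_decr (ltW a0) ltr01 (ltW y1); rewrite powR1.
apply: (@integral_geometric R n _ (\1_(eball 2)) (fun k =>
  eball k%:R) 2^-1 (2 `^ (- a))) => //.
- by move=> y; rewrite mulr_ge0// powR_ge0.
- exact: integral_indic_eball.
- by move=> k; exact: measurable_eball.
- apply/nondecreasing_seqP => k; apply/subsetPset => y /= /le_trans; apply.
  by rewrite ler_nat.
- move=> y _; exists (Num.trunc (enorm y)).+1 => /=.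
  by apply: ltW; rewrite truncnS_gt.
- move=> k; apply: (@le_lt_trans _ _ (\int[mu]_y (\1_(eball k%:R) y)%:E)%E).
    rewrite integral_mkcond; apply: ge0_le_integral => //.
    + by move=> y _; rewrite patchE; case: ifP => // _;
        rewrite lee_fin mulr_ge0// powR_ge0.
    + apply/(measurable_restrictT _ (measurable_eball _)).
      by apply/measurable_EFinP; exact: measurable_funTS.
    + exact/measurable_EFinP.
    + by move=> y _; rewrite patchE [X in (_ <= X%:E)%E]indicE; case: ifP => _;
        rewrite lee_fin// Fle1.
  exact: integral_indic_eball.
- rewrite powR_ge0/= exprVn powRN ltf_pV2 ?posrE ?powR_gt0 ?exprn_gt0//.
  by rewrite -powR_mulrn// gt1_ltr_powR// ltr1n.
- by move=> k y; rewrite /eball/= enormZ ger0_norm//; have := enorm_ge0 y; lra.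
- move=> y; have [y2|y2] := leP (enorm y) 2.
    have y2' : y \in eball 2 by rewrite inE.
    by rewrite [X in _ <= X + _]indicE y2' (le_trans (Fle1 _))// lerDl !mulr_ge0
      ?powR_ge0.
  rewrite enormZ ger0_norm// powRM ?enorm_ge0// h2.
  rewrite [X in _ <= _ + X](_ : _ = \1_(~` eball 1) (2^-1 *: y) * enorm y `^ (- a));
    last first.
    by rewrite mulrCA [X in _ * X]mulrA h2' mul1r.
  rewrite [X in _ <= X + _]indicE memNset; last by move=> yle;
    have := lt_le_trans y2 yle; rewrite ltxx.
  rewrite add0r !indicE !mem_set ?mul1r// /eball/= ?enormZ ?ger0_norm//.
  all: by move=> h; have := y2; lra.
Qed.

Lemma integral_weight p : n%:R < p ->
  (\int[mu]_y ((1 + enorm y `^ p)^-1)%:E < +oo)%E.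
Proof.
move=> np.
have mm : measurable_fun setT (fun y => enorm y `^ p) by exact: measurable_powR_enorm.
have m1 r : measurable_fun setT (\1_(~` eball r) : _ -> R).
  by apply: measurable_indic; exact: (measurableC (measurable_eball _)).
apply: (@le_lt_trans _ _ (\int[mu]_y ((\1_(eball 1) y)%:E +
    (\1_(~` eball 1) y * enorm y `^ (- p))%:E))%E); last first.
  rewrite ge0_integralD//.
  - by rewrite lte_add_pinfty ?integral_indic_eball ?integral_enorm_infty.
  - by apply/measurable_EFinP; exact: measurable_indic_eball.
  - by move=> y _; rewrite lee_fin mulr_ge0// powR_ge0.
  - apply/measurable_EFinP; apply: measurable_funM => //; exact: measurable_powR_enorm.
apply: ge0_le_integral => //.
- by move=> y _; rewrite lee_fin invr_ge0 addr_ge0// powR_ge0.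
- apply/measurable_EFinP; apply: measurable_funV_ge0; last exact: measurable_funD.
  by move=> y; rewrite addr_ge0// powR_ge0.
- apply: emeasurable_funD; first by apply/measurable_EFinP;
    exact: measurable_indic_eball.
  apply/measurable_EFinP; apply: measurable_funM => //; exact: measurable_powR_enorm.
- move=> y _; rewrite -EFinD lee_fin !indicE in_setC.
  have := powR_ge0 (enorm y) p; case: (boolP (y \in eball 1)) => h p0 /=.
    by rewrite mul0r addr0 invf_le1 ?ltr_wpDr// lerDl.
  have {h} y1 : 1 < enorm y by move: h; rewrite notin_setE/= => /negP; rewrite -ltNge.
  rewrite mul1r add0r powRN lef_pV2 ?posrE ?ltr_wpDr ?powR_gt0 ?(lt_trans _ y1)//.
  by rewrite lerDr.
Qed.

End power_integrals.

(* The dirac measure on the one-point space 'rV_0 makes lebesgue_rV 1 the image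
   of the Lebesgue measure of the line. *)
Lemma integral_powRN_unit (R : realType) (s : R) : 0 < s < 1 ->
  (\int[lebesgue_measure]_(t in `]0%R, 1%R[) ((1 - t) `^ (- s))%:E < +oo)%E.
Proof.
move=> s01; have := @integral_enorm_near0 R 1 s; rewrite s01 => /(_ isT).
set F := (F in (\int[_]_y (F y)%:E)%E) => Ffin.
have mF : measurable_fun setT F.
  apply: measurable_funM; first exact: measurable_indic_eball.
  exact: measurable_powR_enorm.
have F0 y : 0 <= F y by rewrite mulr_ge0// powR_ge0.
rewrite (@ge0_integral_rV_step R 0 (EFin \o F)) in Ffin; last 2 first.
- exact/measurable_EFinP.
- by move=> y; rewrite lee_fin.
pose h (x : measurableTypeR R) := F (rV_cons (x, 0 : 'rV[R]_0)).
have hE x : (\int[lebesgue_rV R 0]_v (EFin \o F) (rV_cons (x, v)) = (h x)%:E)%E.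
  rewrite /= integral_dirac//=; first by rewrite diracT mul1e.
  have := @measurable_rV_cons R 0.
  move=> /(measurableT_comp mF) mFc; apply/measurable_EFinP.
  exact: (measurable_fun_pair2 x mFc).
have mh : measurable_fun setT h.
  exact: (measurable_fun_pair1 _ (measurableT_comp mF (@measurable_rV_cons R 0))).
have {}Ffin : (\int[lebesgue_measure]_x (h x)%:E < +oo)%E.
  apply: le_lt_trans Ffin; rewrite le_eqVlt; apply/orP; left; apply/eqP.
  by apply: eq_integral => x _; rewrite -hE.
have hE1 (x : R) : enorm (rV_cons (x, 0 : 'rV[R]_0)) = `|x|.
  by rewrite /enorm big_ord1 mxE unlift_none /= sqrtr_sqr.
(* The reflection x -> 1 - x carries the singularity from 0 to 1. *)
have : (\int[lebesgue_measure]_x (h (-1 * x + 1)%R)%:E < +oo)%E.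
  have mhE : measurable_fun setT (EFin \o h) by exact/measurable_EFinP.
  have n1 : -1 != 0 :> R by rewrite oppr_eq0 oner_eq0.
  have h0 x : (0 <= (EFin \o h) x)%E by rewrite /= lee_fin; exact: F0.
  rewrite [X in (X < _)%E](ge0_integral_affine 1 n1 mhE h0).
  by rewrite normrN1 invr1 mul1e.
apply: le_lt_trans; rewrite integral_mkcond; apply: ge0_le_integral => //.
- by move=> x _; rewrite patchE; case: ifP => // _; rewrite lee_fin powR_ge0.
- apply/(measurable_restrictT _ (measurable_itv _)).
  apply/measurable_EFinP; apply: measurable_funTS.
  apply: (measurableT_comp (measurable_powR (- s))); exact: measurable_funB.
- apply/measurable_EFinP; apply: (measurableT_comp mh);
    exact: (@measurable_affine R (-1) 1).
- move=> x _; rewrite patchE; case: ifP => [|_]; last by rewrite lee_fin; exact: F0.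
  rewrite inE/= in_itv/= => /andP[x0 x1]; rewrite lee_fin /h /F indicE hE1.
  have xE : `|-1 * x + 1| = 1 - x.
    by rewrite mulN1r addrC ger0_norm// subr_ge0 ltW.
  have -> : rV_cons (-1 * x + 1, 0 : 'rV[R]_0) \in eball 1.
    by rewrite inE /eball/= hE1 xE; lra.
  by rewrite xE mul1r.
Qed.

(** * Smooth bumps *)

Section flat.
Context {R : realType}.
Implicit Types (p q : {poly R}) (x t : R).

(** Each monomial y^i is i! times one term of the exponential series. *)
Lemma horner_le_expR p : exists2 C, 0 <= C & forall y, 0 <= y -> `|p.[y]| <= C * expR y.
Proof.
exists (\sum_(i < size p) `|p`_i| * (i`!)%:R) => [|y y0].
  by apply: sumr_ge0 => i _; rewrite mulr_ge0.
rewrite horner_coef (le_trans (ler_norm_sum _ _ _))// mulr_suml ler_sum// => i _.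
rewrite normrM normrX (ger0_norm y0) -mulrA ler_wpM2l//.
case: i => -[|i] /= _.
  by rewrite expr0 mul1r -expR0 ler_expR.
have := expR_ge1Dxn i y0; have f0 : 0 < (i.+1)`!%:R :> R by rewrite ltr0n fact_gt0.
rewrite -ler_pdivrMl// mulrC; by apply: le_trans; rewrite lerDr.
Qed.

(** The classical flat function e^(-1/x); the polynomial factor in 1/x makes the family stable under
    differentiation. *)
Definition flat p x : R := if 0 < x then p.[x^-1] * expR (- x^-1) else 0.

(** Two powers of 1/x are absorbed into the polynomial, which the exponential still dominates.
    Quadratic decay is what makes the derivative at 0 vanish. *)
Lemma flat_le_sqr p : exists2 C, 0 <= C & forall x, `|flat p x| <= C * x ^+ 2.
Proof.
have [C C0 h] := horner_le_expR (p * 'X^2); exists C => // x.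
rewrite /flat; case: ltP => x0; last by rewrite normr0 mulr_ge0// sqr_ge0.
have xi0 : 0 <= x^-1 by rewrite invr_ge0 ltW.
have := h _ xi0; rewrite hornerM hornerXn normrM normrX (ger0_norm xi0) => h1.
rewrite normrM (ger0_norm (expR_ge0 _)) expRN.
rewrite ler_pdivrMr ?expR_gt0// mulrAC -ler_pdivrMr ?exprn_gt0//.
by rewrite -exprVn.
Qed.

Lemma is_derive0_le_sqr (f : R -> R) (C : R) :
  (forall x, `|f x| <= C * x ^+ 2) -> is_derive (0 : R) 1 f 0.
Proof.
move=> fC; have f0 : f 0 = 0.
  by apply/eqP; rewrite -normr_le0 (le_trans (fC 0))// expr0n mulr0.
(* At z = 0 this slope takes the default value 0, which is the derivative claimed. *)
apply/is_derive1_caratheodory; exists (fun z => f z / z); split.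
- move=> z; rewrite f0 !subr0; have [->|z0] := eqVneq z 0.
    by rewrite f0 mul0r mul0r.
  by rewrite divfK.
- have C0 : 0 <= C by have := fC 1; rewrite expr1n mulr1; apply: le_trans.
  apply/cvgrPdist_le => /= e e0; rewrite f0 mul0r; near=> z.
  rewrite sub0r normrN normrM normfV.
  have [->|z0] := eqVneq z 0; first by rewrite normr0 invr0 mulr0 ltW.
  rewrite ler_pdivrMr ?normr_gt0// (le_trans (fC _))//.
  rewrite -real_normK ?num_real// expr2 mulrA ler_wpM2r//.
  apply: (@le_trans _ _ ((C + 1) * `|z|)).
    by rewrite ler_wpM2r// lerDl.
  rewrite mulrC -ler_pdivlMr ?ltr_wpDl//.
  have : `|0 - z| <= e / (C + 1).
    by near: z; apply: cvgr_dist_le => //; rewrite divr_gt0// ltr_wpDl.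
  by rewrite sub0r normrN.
- by rewrite f0 mul0r.
Unshelve. all: by end_near. Qed.

(** With y = 1/x, d/dx = - y^2 d/dy sends p(y) e^-y to y^2 (p - p')(y) e^-y. *)
Definition dflat p : {poly R} := (p - p^`()) * 'X^2.

Lemma is_derive_flat p x : is_derive x 1 (flat p) (flat (dflat p) x).
Proof.
have [x0|x0|->] := ltgtP x 0.
- have -> : flat (dflat p) x = 0 by rewrite /flat ltNge (ltW x0).
  apply: (near_eq_is_derive _ (is_derive_cst (0 : R) x (1 : R))).
  near=> z; rewrite /flat ltNge; have -> // : z <= 0.
  by apply/ltW; near: z; apply: lt_nbhsl.
- have -> : flat (dflat p) x = (dflat p).[x^-1] * expR (- x^-1) by rewrite /flat x0.
  have dV : is_derive x 1 (fun z : R => z^-1) (- x ^- 2 *: 1).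
    by apply: (@is_deriveV _ id); rewrite ?gt_eqF.
  have dVN : is_derive x 1 (fun z : R => - z^-1) (- (- x ^- 2 *: 1)).
    exact: is_deriveN.
  have dp := is_derive1_comp (is_derive_poly p x^-1) dV.
  have de := @is_derive1_comp _ expR (fun z : R =>
    - z^-1) x _ _ (is_derive_expR (- x^-1)) dVN.
  have := is_deriveM dp de.
  move=> /(near_eq_is_derive _) df.
  apply: (is_derive_eq (df _ _)); first near=> z.
    rewrite /flat; have -> // : 0 < z.
    by near: z; apply: lt_nbhsr.
  rewrite /dflat hornerM hornerXn hornerD hornerN -exprVn /= /GRing.scale /=.
  ring.
- have -> : flat (dflat p) 0 = 0 by rewrite /flat ltxx.
  by have [C _ h] := flat_le_sqr p; apply: is_derive0_le_sqr h.
Unshelve. all: by end_near. Qed.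

(** A class that contains one bump on ]1, 2[ and its derivatives of all orders, without a formula
    for them. *)
Inductive bumpfn : (R -> R) -> Prop :=
| bump_flat p q : bumpfn (fun t => flat p (t - 1) * flat q (2 - t))
| bumpD f g : bumpfn f -> bumpfn g -> bumpfn (fun t => f t + g t).

Lemma bump_is_derive f : bumpfn f ->
  exists2 g, bumpfn g & forall t, is_derive t 1 f (g t).
Proof.
elim=> {f} [p q|f g _ [f' bf' df] _ [g' bg' dg]]; last first.
  exists (fun t => f' t + g' t); first exact: bumpD.
  by move=> t; exact: is_deriveD.
(* Leibniz's rule; the sign coming from 2 - t goes into the polynomial of the second factor. *)
exists (fun t => flat (dflat p) (t - 1) * flat q (2 - t) +
                 flat p (t - 1) * flat (- dflat q) (2 - t)).
  by apply: bumpD; exact: bump_flat.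
move=> t.
have d1 : is_derive t 1 (fun t : R => t - 1) (1 - 0).
  by apply: is_deriveB.
have d2 : is_derive t 1 (fun t : R => 2 - t) (0 - 1).
  by apply: is_deriveB.
have dp := @is_derive1_comp _ _ (fun t : R =>
  t - 1) t _ _ (is_derive_flat p (t - 1)) d1.
have dq := @is_derive1_comp _ _ (fun t : R =>
  2 - t) t _ _ (is_derive_flat q (2 - t)) d2.
apply: (is_derive_eq (is_deriveM dp dq)) => /=.
have -> : flat (- dflat q) (2 - t) = - flat (dflat q) (2 - t).
  by rewrite /flat; case: ifP => _; rewrite ?oppr0// hornerN mulNr.
rewrite /GRing.scale /=; ring.
Qed.

Lemma bump_eq0 f t : bumpfn f -> t <= 1 \/ 2 <= t -> f t = 0.
Proof.
move=> + ht; elim=> {f} [p q|f g _ -> _ ->]; last by rewrite addr0.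
rewrite /flat; case: ht => ht.
  by rewrite (ltNge 0 (t - 1)) subr_le0 ht mul0r.
by rewrite [X in _ * X]ifF ?mulr0// ltNge subr_le0 ht.
Qed.

Lemma bump_bounded f : bumpfn f -> exists2 C, 0 <= C & forall t, `|f t| <= C.
Proof.
elim=> {f} [p q|f g _ [C C0 hf] _ [D D0 hg]]; last first.
  exists (C + D); first exact: addr_ge0.
  by move=> t; rewrite (le_trans (ler_normD _ _))// lerD.
have [C C0 hp] := flat_le_sqr p; have [D D0 hq] := flat_le_sqr q.
exists (C * D) => [|t]; first exact: mulr_ge0.
have [t1|t1] := leP t 1.
  by rewrite (bump_eq0 (bump_flat p q)) ?normr0 ?mulr_ge0//; left.
have [t2|t2] := leP 2 t.
  by rewrite (bump_eq0 (bump_flat p q)) ?normr0 ?mulr_ge0//; right.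
(* Both arguments now lie in ]0, 1[, where the quadratic bound is at most its constant. *)
rewrite normrM ler_pM//.
  by rewrite (le_trans (hp _))// ler_piMr// expr_le1//; lra.
by rewrite (le_trans (hq _))// ler_piMr// expr_le1//; lra.
Qed.

Lemma bump_continuous f : bumpfn f -> continuous f.
Proof.
move=> /bump_is_derive[g _ df] t.
by apply: differentiable_continuous; apply/derivable1_diffP; have [] := df t.
Qed.

Definition bump1 (t : R) : R := flat 1 (t - 1) * flat 1 (2 - t).

Lemma bump_bump1 : bumpfn bump1. Proof. exact: bump_flat. Qed.

Lemma bump1_ge0 t : 0 <= bump1 t.
Proof.
by rewrite mulr_ge0// /flat; case: ifP; rewrite ?hornerC ?mul1r ?expR_ge0.
Qed.

Lemma bump1_gt0 t : 1 < t < 2 -> 0 < bump1 t.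
Proof.
move=> /andP[t1 t2]; rewrite /bump1 /flat !subr_gt0 t1 t2 !hornerC !mul1r.
by rewrite mulr_gt0// expR_gt0.
Qed.

End flat.

(** * The Abel-type transform of a bump *)

(** Differentiation under the integral sign with a proposed derivative [f'], in a form that composes
    with the rules for [is_derive]. *)
Lemma is_derive_Rintegral (R : realType) d (Y : measurableType d)
    (mu : {measure set Y -> \bar R}) (f f' : R -> Y -> R) (B : set Y)
    (a u v : R) (G : Y -> R) :
  measurable B -> u < a < v ->
  (forall x, u < x < v -> mu.-integrable B (EFin \o f x)) ->
  (forall x y, u < x < v -> B y -> is_derive x 1 (f ^~ y) (f' x y)) ->
  (forall y, 0 <= G y) -> mu.-integrable B (EFin \o G) ->
  (forall x y, u < x < v -> B y -> `|f' x y| <= G y) ->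
  is_derive a 1 (fun x => \int[mu]_(y in B) f x y) (\int[mu]_(y in B) f' a y).
Proof.
move=> mB auv intf df G0 intG fG.
have Ia : `]u, v[%classic a by rewrite /= in_itv.
have II x : `]u, v[%classic x -> u < x < v by rewrite /= in_itv.
have d1E x y : u < x < v -> B y -> partial1of2 f x y = f' x y.
  by move=> xuv By; rewrite partial1of2E; have [] := df x y xuv By.
have hint x : `]u, v[%classic x -> mu.-integrable B (EFin \o f x) by move/II/intf.
have hder x y : `]u, v[%classic x -> B y -> derivable (f ^~ y) x 1.
  by move=> /II xuv /(df _ _ xuv)[].
have hub x y : `]u, v[%classic x -> B y -> `|partial1of2 f x y| <= G y.
  by move=> /II xuv By; rewrite d1E// fG.
apply: DeriveDef; first exact: (derivable_under_integral mB Ia hint hder G0 intG hub).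
rewrite -derive1E (differentiation_under_integral mB Ia hint hder G0 intG hub).
by apply: eq_Rintegral => y /[!inE] By; rewrite d1E.
Qed.

Section Tk.
Context {R : realType}.
Variable s : R.
Hypothesis s01 : 0 < s < 1.
Implicit Types (f g : R -> R) (m q t : R).
Local Notation mu := (@lebesgue_measure R).

Definition wt m t : R := t `^ m * (1 - t) `^ (- s).

(** For [bump1] this is the G of the overview. The bump and the exponent are parameters because
    differentiation in q changes both; the singular weight does not depend on q. *)
Definition Tk m f q : R := \int[mu]_(t in `]0, 1[) (f (q * t) * wt m t).

Lemma wt_ge0 m t : 0 <= wt m t.
Proof. by rewrite mulr_ge0 ?powR_ge0. Qed.

Lemma measurable_wt m : measurable_fun setT (wt m).
Proof.
apply: measurable_funM; first exact: measurable_powR.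
apply: (measurableT_comp (measurable_powR (- s))); exact: measurable_funB.
Qed.

Lemma wt_le m t : 0 <= m -> 0 < t < 1 -> wt m t <= (1 - t) `^ (- s).
Proof.
move=> m0 /andP[t0 t1]; rewrite ler_piMl ?powR_ge0//.
apply: (@le_trans _ _ (1 `^ m)); last by rewrite powR1.
by apply: ge0_ler_powR; rewrite ?nnegrE// ltW.
Qed.

Lemma integrable_powRN_unit :
  mu.-integrable `]0, 1[ (fun t => ((1 - t) `^ (- s))%:E).
Proof.
apply/integrableP; split.
  apply/measurable_EFinP; apply: measurable_funTS.
  apply: (measurableT_comp (measurable_powR (- s))); exact: measurable_funB.
under eq_integral do rewrite gee0_abs ?lee_fin ?powR_ge0//.
exact: integral_powRN_unit.
Qed.

Lemma integrableZ_powRN_unit (C : R) :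
  mu.-integrable `]0, 1[ (fun t => (C * (1 - t) `^ (- s))%:E).
Proof. exact: (integrableZl _ C integrable_powRN_unit). Qed.

Lemma measurable_bump f : bumpfn f -> measurable_fun setT f.
Proof. by move=> /bump_continuous; exact: continuous_measurable_fun. Qed.

Lemma measurable_Tk m f q : bumpfn f -> measurable_fun setT (fun t =>
  f (q * t) * wt m t).
Proof.
move=> /measurable_bump mf; apply: measurable_funM; last exact: measurable_wt.
by apply: (measurableT_comp mf); exact: measurable_funM.
Qed.

Lemma integrable_Tk m f q : 0 <= m -> bumpfn f ->
  mu.-integrable `]0, 1[ (EFin \o (fun t => f (q * t) * wt m t)).
Proof.
move=> m0 bf; have [C C0 fC] := bump_bounded bf.
apply: (@le_integrable _ _ _ mu _ _ _ (fun t => (C * (1 - t) `^ (- s))%:E)) => //.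
- by apply/measurable_EFinP; apply: measurable_funTS; exact: measurable_Tk.
- move=> t /=; rewrite in_itv/= => t01; rewrite lee_fin normrM.
  rewrite [leRHS]ger0_norm ?mulr_ge0 ?powR_ge0// (ger0_norm (wt_ge0 _ _)).
  by rewrite ler_pM// ?wt_ge0// wt_le.
- exact: integrableZ_powRN_unit.
Qed.

(** The inner derivative t raises the exponent of the weight by one, and a bound of [f'] times (1 -
    t)^-s is a majorant for all q. *)
Lemma Tk_is_derive m f f' q : 0 <= m -> bumpfn f -> bumpfn f' ->
  (forall t, is_derive t 1 f (f' t)) -> is_derive q 1 (Tk m f) (Tk (m + 1) f' q).
Proof.
move=> m0 bf bf' df; have [C C0 fC] := bump_bounded bf'.
have wtS t : 0 < t -> wt (m + 1) t = t * wt m t.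
  move=> t0; rewrite /wt (@powRD _ t m 1) ?(gt_eqF t0) ?implybT//.
  by rewrite powRr1 ?ltW// (mulrC (t `^ m)) mulrA.
pose f2 q t := f' (q * t) * wt (m + 1) t.
apply: (@is_derive_Rintegral _ _ _ mu (fun q t => f (q * t) * wt m t) f2 _ q
  (q - 1) (q + 1) (fun t => C * (1 - t) `^ (- s))) => //.
- by apply/andP; split; lra.
- by move=> x _; exact: integrable_Tk.
- move=> x t _ /=; rewrite in_itv/= => /andP[t0 _].
  have dt : is_derive x 1 (fun x : R => x * t) t.
    have := is_deriveM (is_derive_id x (1 : R)) (is_derive_cst t x (1 : R)).
    by rewrite scaler0 add0r /GRing.scale/= mulr1.
  have dc := @is_derive1_comp _ f (fun x : R => x * t) x _ _ (df (x * t)) dt.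
  have := is_deriveM dc (is_derive_cst (wt m t) x (1 : R)).
  rewrite scaler0 add0r => d; apply: (is_derive_eq d).
  by rewrite /f2 wtS// /GRing.scale/= [LHS]mulrC -mulrA.
- by move=> t; rewrite mulr_ge0// powR_ge0.
- exact: integrableZ_powRN_unit.
- move=> x t _ /=; rewrite in_itv/= => t01.
  rewrite normrM (ger0_norm (wt_ge0 _ _)).
  by rewrite ler_pM ?wt_ge0// wt_le// addr_ge0.
Qed.

Lemma Tk_continuous m f : 0 <= m -> bumpfn f -> continuous (Tk m f).
Proof.
move=> m0 bf q; have [f' bf' df] := bump_is_derive bf.
apply: differentiable_continuous; apply/derivable1_diffP.
by have [] := Tk_is_derive q m0 bf bf' df.
Qed.

Lemma Tk_eq0 m f q : bumpfn f -> q <= 1 -> Tk m f q = 0.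
Proof.
move=> bf q1; rewrite -[RHS](mul0r (fine (mu `]0%R, 1%R[%classic))).
rewrite -Rintegral_cst//; apply: eq_Rintegral.
move=> t /[!inE] /=; rewrite in_itv/= => /andP[t0 t1].
rewrite (bump_eq0 bf) ?mul0r//; left.
have [q0|q0] := leP q 0; last by rewrite mulr_ile1 ?(ltW q0) ?(ltW t0) ?(ltW t1).
by rewrite (le_trans _ ler01)// mulr_le0_ge0// ltW.
Qed.

(** For large q the integrand lives on an interval of length 1/q, on which t^m is O(q^-m) and 1 - t
    stays away from 0. *)
Lemma Tk_bound m f : 0 <= m -> bumpfn f ->
  exists2 C, 0 <= C & forall q, 0 < q -> `|Tk m f q| <= C * q `^ (- (m + 1)).
Proof.
move=> m0 bf; have [C C0 fC] := bump_bounded bf.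
pose I := \int[mu]_(t in `]0, 1[) ((1 - t) `^ (- s)).
have I0 : 0 <= I by apply: Rintegral_ge0 => t _; exact: powR_ge0.
have Tle q (g : R -> R) : mu.-integrable `]0, 1[ (EFin \o g) ->
    (forall t, 0 < t < 1 -> `|f (q * t) * wt m t| <= g t) ->
    `|Tk m f q| <= \int[mu]_(t in `]0, 1[) (g t).
  move=> ig h; apply: (le_trans (le_normr_Rintegral _ (integrable_Tk q m0 bf))) => //.
  apply: le_Rintegral => //.
  exact: (integrable_norm (integrable_Tk q m0 bf)).
exists (C * I * 4 `^ (m + 1) + C * (2 `^ m * 2 `^ s)) => [|q q0].
  by rewrite !addr_ge0 ?mulr_ge0 ?powR_ge0.
(* Beyond 4 the interval ]1/q, 2/q[ lies in ]0, 1/2[, far from the singularity; up to 4 a constant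
   bound suffices. *)
have [q4|q4] := leP q 4.
  apply: (@le_trans _ _ (C * I)).
    rewrite -RintegralZl//; last exact: integrable_powRN_unit.
    apply: Tle; first exact: integrableZ_powRN_unit.
    move=> t t01; rewrite normrM (ger0_norm (wt_ge0 _ _)).
    by rewrite ler_pM// ?wt_ge0// wt_le.
  apply: (@le_trans _ _ (C * I * 4 `^ (m + 1) * q `^ (- (m + 1)))); last first.
    by rewrite ler_wpM2r ?powR_ge0// lerDl !mulr_ge0 ?powR_ge0.
  rewrite -mulrA ler_peMr ?mulr_ge0//.
  rewrite powRN ler_pdivlMr ?powR_gt0// mul1r.
  by apply: ge0_ler_powR; rewrite ?nnegrE ?addr_ge0// ltW.
pose K := C * ((2 / q) `^ m * 2 `^ s).
have K0 : 0 <= K by rewrite !mulr_ge0 ?powR_ge0.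
pose J : set R := `]q^-1, 2 / q[%classic.
have mJ : measurable J by exact: measurable_itv.
have iJ : mu.-integrable `]0, 1[ (EFin \o \1_J).
  exact: (integrableS measurableT _ _ (integrable_indic_itv _ _ _ _)).
apply: (@le_trans _ _ (\int[mu]_(t in `]0, 1[) (K * \1_J t))).
  apply: Tle; first exact: (integrableZl _ K iJ).
  move=> t /andP[t0 t1]; have [tq|tq] := boolP (q^-1 < t < 2 / q).
    rewrite indicE mem_set ?mulr1//.
    rewrite normrM (ger0_norm (wt_ge0 _ _)) ler_pM ?wt_ge0//.
    case/andP: tq => _ tq; rewrite ler_pM ?powR_ge0//.
      by apply: ge0_ler_powR; rewrite ?nnegrE ?divr_ge0// ltW.
    have t2 : 2^-1 <= 1 - t.
      have : 2 / q <= 2^-1 by rewrite ler_pdivrMr//; lra.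
      by move: tq; lra.
    have -> : 2 `^ s = 2^-1 `^ (- s) by rewrite -powR_inv1// -powRrM mulN1r opprK.
    by apply: powR_decr => //; case/andP: s01 => /ltW.
  suff -> : f (q * t) = 0 by rewrite mul0r normr0 mulr_ge0.
  apply: (bump_eq0 bf).
  move: tq; rewrite negb_and -!leNgt => /orP[tq|tq]; [left|right].
    by rewrite mulrC -ler_pdivlMr// div1r.
  by rewrite mulrC -ler_pdivrMr.
rewrite RintegralZl//.
have IJ : \int[mu]_(t in `]0, 1[) (\1_J t) <= q^-1.
  rewrite /Rintegral integral_indic//.
  have muJ : mu J = (q^-1)%:E.
    rewrite lebesgue_measure_itv/= lte_fin ltr_pdivlMr// mulVf ?gt_eqF// ltr1n/=.
    by rewrite -EFinB; congr EFin; field; rewrite gt_eqF.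
  have muJI : (mu (J `&` `]0%R, 1%R[) <= (q^-1)%:E)%E.
    by rewrite -muJ le_measure ?inE//; exact: measurableI.
  by rewrite -lee_fin fineK// ge0_fin_numE// (le_lt_trans muJI)// ltry.
apply: (le_trans (ler_wpM2l K0 IJ)).
apply: (@le_trans _ _ (C * (2 `^ m * 2 `^ s) * q `^ (- (m + 1)))); last first.
  by rewrite ler_wpM2r ?powR_ge0// lerDr !mulr_ge0 ?powR_ge0.
rewrite opprD powRD ?(gt_eqF q0) ?implybT// powR_inv1 ?(ltW q0)//.
rewrite /K powRM ?invr_ge0 ?(ltW q0)// -powR_inv1 ?(ltW q0)// -powRrM mulN1r.
by rewrite le_eqVlt; apply/orP; left; apply/eqP; ring.
Qed.

End Tk.

(** A zero integral would make [f] vanish almost everywhere, against the positive length of []a,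
    b[]. *)
Lemma ge0_integral_gt0 (R : realType) (f : R -> R) (a b : R) : a < b ->
  measurable_fun setT f -> (forall x, 0 <= f x) -> (forall x, a < x < b -> 0 < f x) ->
  (0 < \int[lebesgue_measure]_x (f x)%:E)%E.
Proof.
move=> ab mf f0 fab; rewrite lt_neqAle integral_ge0 ?andbT; last first.
  by move=> x _; rewrite lee_fin.
apply/eqP => /esym If0.
have mfE : measurable_fun setT (EFin \o f) by exact/measurable_EFinP.
have : (\int[lebesgue_measure]_x `|(EFin \o f) x| = 0)%E.
  by rewrite -[RHS]If0; apply: eq_integral => x _; rewrite gee0_abs ?lee_fin.
move/(ae_eq_integral_abs (@lebesgue_measure R) measurableT mfE) => [N [mN N0 fN]].
have : (lebesgue_measure `]a, b[ <= lebesgue_measure N)%E.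
  apply: le_measure; rewrite ?inE//.
  move=> x /=; rewrite in_itv/= => xab; apply: fN => /= /(_ I) [] fx0.
  by have := fab x xab; rewrite fx0 ltxx.
rewrite N0 lebesgue_measure_itv/= lte_fin ab -EFinB lee_fin.
by rewrite leNgt subr_gt0 ab.
Qed.

(** * Scaling and asymptotics of the transform *)

Section Tk_scaling.
Context {R : realType}.
Variable s : R.
Hypothesis s01 : 0 < s < 1.
Implicit Types (f : R -> R) (m q t a th : R).
Local Notation mu := (@lebesgue_measure R).

(** The integrand of [Tk] before rescaling. In this form the kernel appears, with t = r^2 and q =
    |y|^2. *)
Definition abel m f q t : R :=
  (\1_(`]0, q[%classic : set R) t) * (f t * (t `^ m * (q - t) `^ (- s))).

Lemma abel_ge0 m f q t : (forall t, 0 <= f t) -> 0 <= abel m f q t.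
Proof. by move=> f0; rewrite !mulr_ge0 ?powR_ge0. Qed.

Lemma measurable_abel m f q : measurable_fun setT f -> measurable_fun setT (abel m f q).
Proof.
move=> mf; apply: measurable_funM; first exact: measurable_indic.
apply: measurable_funM => //; apply: measurable_funM; first exact: measurable_powR.
apply: (measurableT_comp (measurable_powR (- s))); exact: measurable_funB.
Qed.

Lemma integral_abel m f q : measurable_fun setT f -> (forall t, 0 <= f t) -> 0 < q ->
  (\int[mu]_t (abel m f q t)%:E =
   (q `^ (1 + m - s))%:E * \int[mu]_(t in `]0%R, 1%R[) (f (q * t) * wt s m t)%:E)%E.
Proof.
move=> mf f0 q0.
have mh : measurable_fun setT (EFin \o abel m f q).
  by apply/measurable_EFinP; exact: measurable_abel.
have h0 t : (0 <= (EFin \o abel m f q) t)%E by rewrite lee_fin abel_ge0.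
have q0' : q != 0 by rewrite gt_eqF.
have := ge0_integral_affine 0 q0' mh h0; rewrite (gtr0_norm q0) /= => H.
have -> : (\int[mu]_t (abel m f q t)%:E =
    q%:E * \int[mu]_x (abel m f q (q * x + 0))%:E)%E.
  by rewrite H muleA -EFinM mulfV// mul1e.
have -> : (\int[mu]_x (abel m f q (q * x + 0))%:E =
   \int[mu]_(x in `]0%R, 1%R[) ((q `^ (m - s))%:E * (f (q * x) * wt s m x)%:E))%E.
  rewrite [RHS]integral_mkcond; apply: eq_integral => x _; rewrite addr0 patchE.
  rewrite /abel indicE.
  have -> : (q * x \in (`]0, q[%classic : set R)) = (x \in (`]0, 1[%classic : set R)).
    by apply/idP/idP; rewrite !inE/= !in_itv/= pmulr_rgt0// gtr_pMr.
  case: ifPn => [|_]; last by rewrite mul0r.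
  rewrite inE/= in_itv/= => /andP[x0 x1]; rewrite mul1r -EFinM; congr EFin.
  have -> : q - q * x = q * (1 - x) by rewrite mulrBr mulr1.
  rewrite /wt !powRM ?subr_ge0 ?(ltW x0) ?(ltW x1) ?(ltW q0)//.
  rewrite powRD ?q0' ?implybT//; ring.
rewrite ge0_integralZl//; last 3 first.
- apply/measurable_EFinP; apply: measurable_funTS; apply: measurable_funM.
    by apply: (measurableT_comp mf); exact: measurable_funM.
  exact: measurable_wt.
- by move=> x _; rewrite lee_fin mulr_ge0// wt_ge0.
- by rewrite lee_fin powR_ge0.
by rewrite muleA -EFinM -addrA (@powRD _ q 1 (m - s)) ?q0' ?implybT// powRr1 ?(ltW q0).
Qed.

Lemma measurable_bump1 : measurable_fun setT (@bump1 R).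
Proof. exact: measurable_bump (@bump_bump1 R). Qed.

(** Two of these moments matter: exponent m - s enters V(th), and exponent m is the limit of q^(m +
    1) G(q). *)
Definition mom a : R := \int[mu]_t (bump1 t * t `^ a).

Lemma measurable_mom a : measurable_fun setT (fun t : R => bump1 t * t `^ a).
Proof.
apply: measurable_funM; [exact: measurable_bump1|exact: measurable_powR].
Qed.

Lemma mom_lty a : (\int[mu]_t (bump1 t * t `^ a)%:E < +oo)%E.
Proof.
have [C C0 fC] := bump_bounded (@bump_bump1 R).
(* The exponent may be negative; on ]1, 2[ one has t^a <= t^|a| <= 2^|a| in either case. *)
pose K := C * (2 `^ `|a|).
pose J : set R := `]1, 2[%classic.
have mJ : measurable J by exact: measurable_itv.
have mIJ : measurable_fun setT (\1_J : R -> R) by exact: measurable_indic.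
have K0 : 0 <= K by rewrite mulr_ge0 ?powR_ge0.
apply: (@le_lt_trans _ _ (\int[mu]_t (K * \1_J t)%:E)%E).
  apply: ge0_le_integral => //.
  - by move=> x _; rewrite lee_fin mulr_ge0 ?powR_ge0 ?bump1_ge0.
  - by apply/measurable_EFinP; exact: measurable_mom.
  - by apply/measurable_EFinP; exact: measurable_funM.
  move=> t _; rewrite lee_fin; have [t12|t12] := boolP (1 < t < 2).
    rewrite indicE mem_set// mulr1 ler_pM ?powR_ge0 ?bump1_ge0//.
      by rewrite (le_trans (ler_norm _)).
    case/andP: t12 => t1 t2; apply: (@le_trans _ _ (t `^ `|a|)).
      by apply: ler_powR; rewrite ?ler_norm// ltW.
    by apply: ge0_ler_powR; rewrite ?nnegrE// ltW// (lt_trans ltr01).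
  rewrite (bump_eq0 (@bump_bump1 R)) ?mul0r ?mulr_ge0//.
  by move: t12; rewrite negb_and -!leNgt => /orP[]; [left|right].
under eq_integral do rewrite EFinM.
rewrite ge0_integralZl//.
  have muJ : (mu J < +oo)%E.
    by rewrite lebesgue_measure_itv/=; case: ifP => _; rewrite ltry.
  by rewrite integral_indic// setIT lte_mul_pinfty ?lee_fin.
exact/measurable_EFinP.
Qed.

Lemma mom_gt0E a : (0 < \int[mu]_t (bump1 t * t `^ a)%:E)%E.
Proof.
apply: (@ge0_integral_gt0 _ _ 1 2); first by lra.
- exact: measurable_mom.
- by move=> t; rewrite mulr_ge0 ?powR_ge0 ?bump1_ge0.
- by move=> t t12; rewrite mulr_gt0 ?bump1_gt0// powR_gt0; case/andP: t12; lra.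
Qed.

Lemma momE a : (mom a)%:E = (\int[mu]_t (bump1 t * t `^ a)%:E)%E.
Proof. by rewrite fineK// ge0_fin_numE ?mom_lty// ltW// mom_gt0E. Qed.

Lemma mom_gt0 a : 0 < mom a.
Proof. by rewrite -lte_fin momE mom_gt0E. Qed.

Lemma mom_scale a th : 0 < th ->
  (\int[mu]_t (bump1 (th * t) * t `^ a)%:E = (th `^ (- a - 1) * mom a)%:E)%E.
Proof.
move=> th0; have th0' : th != 0 by rewrite gt_eqF.
have mh : measurable_fun setT (EFin \o (fun t : R => bump1 t * t `^ a)).
  by apply/measurable_EFinP; exact: measurable_mom.
have h0 t : (0 <= (EFin \o (fun t : R => (bump1 t * t `^ a)%R)) t)%E.
  by rewrite lee_fin mulr_ge0 ?powR_ge0 ?bump1_ge0.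
have := ge0_integral_affine 0 th0' mh h0; rewrite (gtr0_norm th0) /= -momE => H.
have -> : (\int[mu]_t (bump1 (th * t) * t `^ a)%:E =
   \int[mu]_t ((th `^ (- a))%:E * (bump1 (th * t + 0) * (th * t + 0) `^ a)%:E))%E.
  apply: eq_integral => t _; rewrite addr0 -EFinM; congr EFin.
  have [t0|t0] := leP t 0.
    rewrite (bump_eq0 (@bump_bump1 R)) ?mul0r ?mulr0//; left.
    by rewrite (le_trans _ ler01)// mulr_ge0_le0// ltW.
  rewrite powRM ?(ltW th0) ?(ltW t0)// powRN mulrCA; congr (_ * _).
  by rewrite mulKf// gt_eqF// powR_gt0.
rewrite ge0_integralZl//; last 3 first.
- by have := measurableT_comp mh (measurable_affine th 0).
- by move=> t _; exact: h0.
- by rewrite lee_fin powR_ge0.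
rewrite H -!EFinM; congr EFin; rewrite mulrA; congr (_ * _).
by rewrite powRD ?th0' ?implybT// powR_inv1 ?(ltW th0).
Qed.

Lemma Tk_bump1_ge0 m q : 0 <= Tk s m bump1 q.
Proof.
by apply: Rintegral_ge0 => t _; rewrite mulr_ge0 ?bump1_ge0 ?wt_ge0.
Qed.

Lemma Tk_bump1_abel m q : 0 <= m -> 0 < q ->
  ((q `^ (1 + m - s) * Tk s m bump1 q)%:E = \int[mu]_t (abel m bump1 q t)%:E)%E.
Proof.
move=> m0 q0; rewrite (integral_abel _ measurable_bump1 (@bump1_ge0 R))//.
by rewrite EFinM /Tk /Rintegral fineK// integrable_fin_num//;
  apply: integrable_Tk => //; exact: bump_bump1.
Qed.

(** Undoing the rescaling turns the middle term into the integral of (1 - t/q)^-s psi(t) t^m, and on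
    the support of psi the first factor lies between 1 and (1 - 2/q)^-s. *)
Lemma Tk_bump1_squeeze m q : 0 <= m -> 2 < q ->
  mom m <= q `^ (m + 1) * Tk s m bump1 q <= (1 - 2 / q) `^ (- s) * mom m.
Proof.
move=> m0 q2; have q0 : 0 < q by exact: lt_trans q2.
have q0' : q != 0 by rewrite gt_eqF.
have -> : q `^ (m + 1) * Tk s m bump1 q = q `^ s * (q `^ (1 + m - s) * Tk s m bump1 q).
  by rewrite [RHS]mulrA -powRD ?q0' ?implybT//; congr (_ `^ _ * _); ring.
have E : ((q `^ s * (q `^ (1 + m - s) * Tk s m bump1 q))%:E =
    \int[mu]_t (q `^ s * abel m bump1 q t)%:E)%E.
  rewrite EFinM Tk_bump1_abel// -ge0_integralZl//.
  - by apply/measurable_EFinP; apply: measurable_abel; exact: measurable_bump1.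
  - by move=> t _; rewrite lee_fin abel_ge0//; exact: bump1_ge0.
  - by rewrite lee_fin powR_ge0.
have mab : measurable_fun setT (fun t => (q `^ s * abel m bump1 q t)%:E).
  apply/measurable_EFinP; apply: measurable_funM => //.
  by apply: measurable_abel; exact: measurable_bump1.
have momm : measurable_fun setT (fun t : R => (bump1 t * t `^ m)%:E).
  by apply/measurable_EFinP; exact: measurable_mom.
have abE t : 1 < t < 2 ->
    q `^ s * abel m bump1 q t = (1 - t / q) `^ (- s) * (bump1 t * t `^ m).
  move=> /andP[t1 t2]; have t0 : 0 < t by exact: lt_trans t1.
  have tq : t < q by exact: lt_trans q2.
  rewrite /abel indicE mem_set/= ?in_itv/= ?t0// mul1r.
  have -> : q - t = q * (1 - t / q) by rewrite mulrBr mulr1 mulrC divfK.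
  rewrite powRM ?(ltW q0) ?subr_ge0 ?ler_pdivrMr ?mul1r ?(ltW tq)//.
  have qs : q `^ s * q `^ (- s) = 1 by rewrite -powRD ?q0' ?implybT// addrN powRr0.
  by rewrite -[RHS]mul1r -qs; ring.
have bm0 t : 0 <= bump1 t * t `^ m :> R by apply: mulr_ge0;
  rewrite ?bump1_ge0 ?powR_ge0.
have ab0 t : ~~ (1 < t < 2) -> q `^ s * abel m bump1 q t = 0 /\ bump1 t = 0.
  move=> t12; have b0 : bump1 t = 0.
    apply: (bump_eq0 (@bump_bump1 R)).
    by move: t12; rewrite negb_and -!leNgt => /orP[]; [left|right].
  by split=> //; rewrite /abel b0 mul0r !mulr0.
rewrite -!lee_fin [X in _ && (_ <= X)%E]EFinM E !momE; apply/andP; split.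
  apply: ge0_le_integral => //.
  - by move=> t _; rewrite lee_fin; apply: mulr_ge0; rewrite ?bump1_ge0 ?powR_ge0.
  move=> t _; rewrite lee_fin; have [t12|/ab0[-> ->]] := boolP (1 < t < 2); last first.
    by rewrite mul0r.
  rewrite abE// ler_peMl//.
  case/andP: t12 => t1 t2; apply: (@le_trans _ _ (1 `^ (- s))); first by rewrite powR1.
  apply: powR_decr.
  - by case/andP: s01 => /ltW.
  - by rewrite subr_gt0 ltr_pdivrMr//; lra.
  - by rewrite gerBl divr_ge0//; lra.
rewrite -ge0_integralZl//; last 2 first.
- by move=> t _; rewrite lee_fin; apply: mulr_ge0; rewrite ?bump1_ge0 ?powR_ge0.
- by rewrite lee_fin powR_ge0.
apply: ge0_le_integral => //.
- by move=> t _; rewrite lee_fin mulr_ge0 ?powR_ge0// abel_ge0//; exact: bump1_ge0.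
- exact: measurable_funeM.
move=> t _; rewrite -EFinM lee_fin; have [t12|/ab0[-> ->]] := boolP (1 < t < 2);
  last first.
  by rewrite mul0r mulr0.
rewrite abE// ler_wpM2r//.
case/andP: t12 => t1 t2; apply: powR_decr.
- by case/andP: s01 => /ltW.
- by rewrite subr_gt0 ltr_pdivrMr//; lra.
- by rewrite lerD2l lerN2 ler_wpM2r// ?invr_ge0; lra.
Qed.

Lemma cvg_Tk_bump1 m (q_ : nat -> R) : 0 <= m -> q_ @ \oo --> +oo ->
  (q_ k `^ (m + 1) * Tk s m bump1 (q_ k)) @[k --> \oo] --> mom m.
Proof.
move=> m0 qoo; apply: (@squeeze_cvgr _ _ _ _ (cst (mom m))
    (fun k => (1 - 2 / q_ k) `^ (- s) * mom m)).
- near=> k; apply: Tk_bump1_squeeze => //.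
  by near: k; apply: (cvgryPgt _).1.
- exact: cvg_cst.
- rewrite -[X in _ --> X]mul1r; apply: cvgM; last exact: cvg_cst.
  have H1 : (1 : R) `^ (- s) = 1 by rewrite powR1.
  rewrite -[X in _ --> X]H1.
  apply: (@continuous_cvg _ _ _ _ _ (fun k => 1 - 2 / q_ k) (fun x : R =>
    x `^ (- s)) 1).
    apply: differentiable_continuous; apply/derivable1_diffP.
    by apply: derivable_powR; rewrite in_itv/= ltr01.
  rewrite -[X in _ --> X]subr0; apply: cvgB; first exact: cvg_cst.
  rewrite -(mulr0 2); apply: cvgM; first exact: cvg_cst.
  apply/gtr0_cvgV0 => //; near=> k.
  by near: k; apply: (cvgryPgt _).1.
Unshelve. all: by end_near. Qed.

End Tk_scaling.

(** * Convolution kernels closed under differentiation *)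

Section directional.
Context {R : realType} {n : nat}.
Implicit Types (x v : 'rV[R]_n) (F : 'rV[R]_n -> R).

(** Reduces directional derivatives to one real variable, where the chain rule and differentiation
    under the integral apply. *)
Lemma is_derive_line F x v (h0 d : R) :
  is_derive (h0 *: v + x) v F d <-> is_derive h0 1 (fun h : R => F (h *: v + x)) d.
Proof.
pose g (h : R) := F (h *: v + x).
have E (h : R) : F (h *: v + (h0 *: v + x)) = g (h *: 1 + h0).
  by rewrite /g addrA -scalerDl /GRing.scale/= mulr1.
have ED : derivable F (h0 *: v + x) v = derivable g h0 1.
  by rewrite /derivable; under eq_fun do rewrite /= E.
have EE : 'D_v F (h0 *: v + x) = 'D_1 g h0.
  by rewrite /derive; under eq_fun do rewrite /= E.
by split=> -[d1 d2]; split; rewrite ?ED ?EE// -?ED -?EE.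
Qed.

Lemma is_derive_line0 F x v (d : R) :
  is_derive x v F d <-> is_derive (0 : R) 1 (fun h : R => F (h *: v + x)) d.
Proof. by rewrite -is_derive_line scale0r add0r. Qed.

Lemma is_derive_coord x v (j : 'I_n) :
  is_derive x v (fun y : 'rV[R]_n => y ord0 j) (v ord0 j).
Proof.
apply/is_derive_line0.
have -> : (fun h : R => (h *: v + x) ord0 j) = (fun h : R => h * v ord0 j + x ord0 j).
  by apply/funext => h; rewrite !mxE.
have d1 := is_deriveM (is_derive_id (0 : R) (1 : R)) (is_derive_cst (v ord0 j) (0 :
  R) (1 : R)).
have d2 := is_deriveD d1 (is_derive_cst (x ord0 j) (0 : R) (1 : R)).
by apply: (is_derive_eq d2); rewrite scaler0 add0r addr0 /GRing.scale/= mulr1.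
Qed.

Lemma is_derive_sqr_enorm x (i : 'I_n) :
  is_derive x (delta_mx ord0 i : 'rV[R]_n) (fun y : 'rV[R]_n =>
    enorm y ^+ 2) (2 * x ord0 i).
Proof.
have -> : (fun y : 'rV[R]_n => enorm y ^+ 2) =
    \sum_(j < n) (fun y : 'rV[R]_n => y ord0 j) ^+ 2.
  by apply/funext => y; rewrite sqr_enorm fct_sumE; apply: eq_bigr => j _;
    rewrite !exprfctE.
have H := @is_derive_sum _ _ _ n (fun j => (fun y : 'rV[R]_n => y ord0 j) ^+ 2) x
  (delta_mx ord0 i) _ (fun j => is_deriveX 2 (is_derive_coord x (delta_mx ord0 i) j)).
apply: (is_derive_eq H); rewrite (bigD1 i)//= big1 => [|j ji].
  by rewrite addr0 mxE !eqxx /GRing.scale/= mulr1 expr1.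
by rewrite mxE (negbTE ji) andbF scaler0.
Qed.

Lemma is_derive_comp_line (T : R -> R) F x v (dT dF : R) :
  is_derive x v F dF -> is_derive (F x) 1 T dT ->
  is_derive x v (fun y => T (F y)) (dT * dF).
Proof.
move=> /is_derive_line0 h hT; apply/is_derive_line0.
apply: (@is_derive1_comp _ T (fun h : R => F (h *: v + x))) => //.
by rewrite scale0r add0r.
Qed.

End directional.

Section ker.
Context {R : realType} {n : nat}.
Variables (s m th : R).
Hypotheses (s01 : 0 < s < 1) (m0 : 0 <= m) (th0 : 0 < th).
Implicit Types (y : 'rV[R]_n) (F : 'rV[R]_n -> R).

(* [ker d F] : linear combinations of y^beta T_{m+j}[f](th |y|^2) with
   |beta| + d <= 2 j, hence O(|y|^-(2 m + 2 + d)) at infinity. *)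
Inductive ker : nat -> ('rV[R]_n -> R) -> Prop :=
| ker_Tk f j : bumpfn f ->
    ker j.*2 (fun y => Tk s (m + j%:R) f (th * enorm y ^+ 2))
| ker_mulX i d F : ker d.+1 F -> ker d (fun y => y ord0 i * F y)
| ker_weak d F : ker d.+1 F -> ker d F
| kerD d F G : ker d F -> ker d G -> ker d (fun y => F y + G y)
| kerZ c d F : ker d F -> ker d (fun y => c * F y).

Lemma ker_eq0 d F y : ker d F -> th * enorm y ^+ 2 <= 1 -> F y = 0.
Proof.
move=> + yth; elim=> {d F} [f j bf|i d F _ ->|d F _ ->|d F G _ -> _ ->|c d F _ ->] //.
- by rewrite Tk_eq0.
- by rewrite mulr0.
- by rewrite addr0.
- by rewrite mulr0.
Qed.

(** In the generators the factor |y|^(2 j) is paid for by the surplus j in the exponent of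
    [Tk_bound]; a coordinate costs one power of |y|, which the index holds in reserve. *)
Lemma ker_bound d F : ker d F -> exists2 C, 0 <= C &
  forall y, `|F y| * (enorm y ^+ d * (1 + enorm y `^ (2 * (m + 1)))) <= C.
Proof.
have w0 d' y : 0 <= enorm y ^+ d' * (1 + enorm y `^ (2 * (m + 1))).
  by rewrite mulr_ge0 ?exprn_ge0 ?enorm_ge0// addr_ge0// powR_ge0.
have m1 : 0 < m + 1 by rewrite ltr_wpDl.
elim=> {d F} [f j bf|i d F _ [C C0 hC]|d F kF [C C0 hC]|d F G _ [C C0 hC] _ [D D0 hD]|c
  d F _ [C C0 hC]].
- have mj : 0 <= m + j%:R by rewrite addr_ge0.
  have [C C0 hC] := Tk_bound s01 mj bf.
  exists (C * (th^-1 ^+ j * (1 + th^-1 `^ (m + 1)))) => [|y].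
    by rewrite !mulr_ge0 ?addr_ge0 ?powR_ge0 ?exprn_ge0// invr_ge0 ltW.
  set q := th * enorm y ^+ 2; have [q1|q1] := leP q 1.
    rewrite (Tk_eq0 _ _ bf q1) normr0 mul0r.
    by rewrite !mulr_ge0 ?addr_ge0 ?powR_ge0 ?exprn_ge0// invr_ge0 ltW.
  have q0 : 0 < q by exact: lt_trans q1.
  have e2 : enorm y ^+ 2 = q * th^-1 by rewrite /q mulrAC mulfV ?mul1r// gt_eqF.
  have ej : enorm y ^+ j.*2 = q ^+ j * th^-1 ^+ j.
    by rewrite -mul2n exprM e2 exprMn.
  have ep : enorm y `^ (2 * (m + 1)) = q `^ (m + 1) * th^-1 `^ (m + 1).
    by rewrite powRrM powR_mulrn ?enorm_ge0// e2 powRM ?invr_ge0 ?ltW.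
  have qj : q `^ (- (m + j%:R + 1)) * q ^+ j = q `^ (- (m + 1)).
    rewrite -powR_mulrn ?(ltW q0)// -powRD ?(gt_eqF q0) ?implybT//.
    by congr (_ `^ _); ring.
  apply: (@le_trans _ _ (C * q `^ (- (m + j%:R + 1)) *
     (enorm y ^+ j.*2 * (1 + enorm y `^ (2 * (m + 1)))))).
    by rewrite ler_wpM2r// hC.
  rewrite ej ep -!mulrA ler_wpM2l// !mulrA qj.
  have qm : q `^ (- (m + 1)) * q `^ (m + 1) = 1.
    by rewrite powRN mulVf// gt_eqF// powR_gt0.
  have -> : q `^ (- (m + 1)) * th^-1 ^+ j * (1 + q `^ (m + 1) * th^-1 `^ (m + 1)) =
     th^-1 ^+ j * (q `^ (- (m + 1)) +  (q `^ (- (m + 1)) * q `^ (m + 1)) * th^-1 `^ (m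
       + 1)) by ring.
  rewrite qm mul1r ler_wpM2l ?exprn_ge0 ?invr_ge0 ?(ltW th0)// lerD2r.
  apply: (@le_trans _ _ (1 `^ (- (m + 1)))); last by rewrite powR1.
  by apply: powR_decr => //; apply: ltW.
- exists C => // y; apply: le_trans (hC y).
  rewrite normrM exprS -!mulrA mulrCA ler_wpM2l// ler_wpM2r//.
  exact: coord_le_enorm.
(* Dropping a power of |y| requires |y| to be bounded below where [F] is nonzero; by [ker_eq0], |y|
   > th^(-1/2) there. *)
- exists (C * Num.sqrt th) => [|y]; first by rewrite mulr_ge0// sqrtr_ge0.
  have [yth|yth] := leP (th * enorm y ^+ 2) 1.
    by rewrite (ker_eq0 kF yth) normr0 mul0r mulr_ge0// sqrtr_ge0.
  have h1 : 1 <= Num.sqrt th * enorm y.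
    rewrite -ler_sqr ?nnegrE ?mulr_ge0 ?sqrtr_ge0 ?enorm_ge0//.
    by rewrite expr1n exprMn sqr_sqrtr ltW.
  apply: (@le_trans _ _ (`|F y| * (enorm y ^+ d.+1 * (1 + enorm y `^ (2 * (m + 1)))) *
    Num.sqrt th)).
    rewrite -mulrA ler_wpM2l// exprS.
    have -> : enorm y * enorm y ^+ d * (1 + enorm y `^ (2 * (m + 1))) * Num.sqrt th =
      (Num.sqrt th * enorm y) * (enorm y ^+ d * (1 + enorm y `^ (2 * (m + 1)))) by ring.
    by rewrite ler_peMl.
  by rewrite ler_wpM2r ?sqrtr_ge0.
- exists (C + D) => [|y]; first exact: addr_ge0.
  apply: (le_trans (ler_wpM2r (w0 _ _) (ler_normD _ _))).
  by rewrite mulrDl lerD.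
- exists (`|c| * C) => [|y]; first by rewrite mulr_ge0.
  by rewrite normrM -mulrA ler_wpM2l.
Qed.

Lemma ker_continuous d F : ker d F -> continuous F.
Proof.
have ce : continuous (fun y : 'rV[R]_n => th * enorm y ^+ 2).
  move=> y.
  apply: (@cvgM R _ (nbhs y) _ (cst th) (fun y : 'rV[R]_n => enorm y ^+ 2));
    first exact: cvg_cst.
  have -> : (fun y : 'rV[R]_n => enorm y ^+ 2) =
    (fun y : 'rV[R]_n => \sum_(j < n) y ord0 j ^+ 2).
    by apply/funext => z; rewrite sqr_enorm.
  rewrite sqr_enorm.
  apply: (cvg_big (@add_continuous R)) => j _.
  by apply: cvgM; exact: coord_continuous.
elim=> {d F} [f j bf|i d F _ cF|d F _ cF|d F G _ cF _ cG|c d F _ cF] // y.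
- apply: (@continuous_comp _ _ _ (fun y : 'rV[R]_n =>
    th * enorm y ^+ 2) (Tk s (m + j%:R) f)).
    exact: ce.
  by apply: Tk_continuous => //; rewrite addr_ge0.
- apply: (@cvgM R _ (nbhs y) _ (fun y : 'rV[R]_n => y ord0 i) F); last exact: cF.
  exact: coord_continuous.
- exact: (cvgD (cF y) (cG y)).
- by apply: (@cvgM R _ (nbhs y) _ (cst c) F); [exact: cvg_cst|exact: cF].
Qed.

Lemma ker_measurable d F : ker d F -> measurable_fun setT F.
Proof.
elim=> {d F} [f j bf|i d F _ mF|d F _ mF|d F G _ mF _ mG|c d F _ mF] //.
- have mT : measurable_fun setT (Tk s (m + j%:R) f).
    by apply: continuous_measurable_fun; apply: Tk_continuous => //; rewrite addr_ge0.
  apply: (measurableT_comp mT); apply: measurable_funM => //.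
  by apply: measurable_funX; exact: measurable_enorm.
- by apply: measurable_funM => //; exact: measurable_coor.
- exact: measurable_funD.
- exact: measurable_funM.
Qed.

Lemma ker_partial d F (i : 'I_n) : ker d F -> exists2 F', ker d F' &
  forall y, is_derive y (delta_mx ord0 i : 'rV[R]_n) F (F' y).
Proof.
elim=> {d F} [f j bf|k d F kF [F' kF' dF]|d F _ [F' kF' dF]|d F G _ [F' kF' dF] _ [G'
  kG' dG]|c d F _ [F' kF' dF]].
- have [f' bf' df] := bump_is_derive bf; have mj : 0 <= m + j%:R by rewrite addr_ge0.
  exists (fun y => (2 * th) * (y ord0 i * Tk s (m + j.+1%:R) f' (th * enorm y ^+ 2))).
    (* Passing from j to j + 1 raises the index by two: the coordinate factor uses one, weakening
       discards the other. *)
    by apply/kerZ/ker_mulX/ker_weak; rewrite -doubleS; exact: ker_Tk.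
  move=> y.
  have dq : is_derive y (delta_mx ord0 i : 'rV[R]_n) (fun y : 'rV[R]_n =>
    th * enorm y ^+ 2) (th * (2 * y ord0 i)).
    have := is_deriveZ th (is_derive_sqr_enorm y i); exact.
  have H := is_derive_comp_line dq (Tk_is_derive s01 (th * enorm y ^+ 2) mj bf bf' df).
  have <- : m + j%:R + 1 = m + j.+1%:R by rewrite -addrA natr1.
  by apply: (is_derive_eq H); ring.
- exists (fun y => (delta_mx ord0 i : 'rV[R]_n) ord0 k * F y + y ord0 k * F' y).
    by apply: kerD; [apply/kerZ/ker_weak|apply: ker_mulX].
  move=> y; apply: (is_derive_eq (is_deriveM (is_derive_coord y (delta_mx ord0 i) k)
    (dF y))).
  by rewrite /GRing.scale/= addrC (mulrC (F y)).
- by exists F' => //; exact: ker_weak.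
- by exists (fun y => F' y + G' y) => [|y]; [exact: kerD|exact: is_deriveD].
- by exists (fun y => c * F' y) => [|y]; [exact: kerZ|exact: is_deriveZ].
Qed.

Lemma ker_bound_translate F (M : R) : ker 0 F -> 0 <= M ->
  exists2 C, 0 <= C & forall x z, enorm x <= M ->
    `|F (x - z)| <= C * (1 + enorm z `^ (2 * (m + 1)))^-1.
Proof.
move=> kF M0; have [C C0 hC] := ker_bound kF.
have p0 : 0 <= 2 * (m + 1) by rewrite mulr_ge0// addr_ge0.
have [D D0 hD] := @weight_translate R n _ _ p0 M0.
exists (C * D) => [|x z xM]; first by rewrite mulr_ge0// ltW.
have w1 z' : 0 < 1 + enorm z' `^ (2 * (m + 1)) :> R by rewrite ltr_wpDr// powR_ge0.
rewrite ler_pdivlMr//; apply: (le_trans (ler_wpM2l _ (hD x z xM))) => //.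
have := hC (x - z); rewrite expr0 mul1r mulrCA => h.
by rewrite (mulrC C) ler_wpM2l// ltW.
Qed.

End ker.

(** * Convolution with a function of L_s *)

(** Dominated convergence is about sequences. If continuity failed, choice would give a sequence
    approaching [x] at rate 1/(k + 1) along which [f] stays away from [f x]. *)
Lemma seq_continuous_rV (R : realType) n (f : 'rV[R]_n -> R) x :
  (forall w : nat -> 'rV[R]_n, (forall k, `|w k - x| <= k.+1%:R^-1) ->
    f (w k) @[k --> \oo] --> f x) -> {for x, continuous f}.
Proof.
move=> h; rewrite /prop_for /continuous_at; apply/(@cvgrPdist_lt _ _ _ _ (nbhs_filter
  x)) => e e0; apply: contrapT => nfx.
have H k : exists y, `|y - x| <= k.+1%:R^-1 /\ e <= `|f x - f y|.
  apply: contrapT => /forallNP H; apply: nfx.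
  apply/nbhs_ballP; exists k.+1%:R^-1 => /=; first by rewrite invr_gt0.
  move=> y; rewrite -ball_normE /= => xy; rewrite ltNge; apply/negP => exy.
  by apply: (H y); split => //; rewrite distrC ltW.
move/choice : H => [w hw].
have := h w (fun k => (hw k).1) => /cvgrPdist_lt/(_ _ e0)[N _ /(_ _ (leqnn N))] /=.
by rewrite ltNge (hw N).2.
Qed.

Section convolution.
Context {R : realType} {n : nat}.
Variables (s m th : R).
Hypotheses (s01 : 0 < s < 1) (m0 : 0 <= m) (th0 : 0 < th).
Local Notation mu := (lebesgue_rV R n).
Local Notation ker := (@ker R n s m th).
Implicit Types (x y z : 'rV[R]_n) (F : 'rV[R]_n -> R).

(** The weight of L_s when 2 (m + 1) = n + 2 s; by [ker_bound] it dominates, up to a constant, every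
    kernel of index 0. *)
Definition weight z : R := (1 + enorm z `^ (2 * (m + 1)))^-1.

Lemma weight_ge0 z : 0 <= weight z.
Proof. by rewrite invr_ge0 addr_ge0// powR_ge0. Qed.

Lemma measurable_weight : measurable_fun setT weight.
Proof.
apply: measurable_funV_ge0 => [z|]; first by rewrite addr_ge0// powR_ge0.
by apply: measurable_funD => //; exact: measurable_powR_enorm.
Qed.

Variable u : 'rV[R]_n -> R.
Hypotheses (mu_ : measurable_fun setT u)
  (iu : (\int[mu]_z (weight z * `|u z|)%:E < +oo)%E).

Lemma integrable_weight_u : mu.-integrable setT (fun z => (weight z * `|u z|)%:E).
Proof.
apply/integrableP; split.
  apply/measurable_EFinP; apply: measurable_funM; first exact: measurable_weight.
  exact: measurableT_comp.
by under eq_integral do rewrite gee0_abs ?lee_fin ?mulr_ge0 ?weight_ge0//.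
Qed.

Lemma measurable_reflect F x : measurable_fun setT F ->
  measurable_fun setT (fun z => F (x - z)).
Proof.
move=> mF; have -> : (fun z => F (x - z)) = F \o (fun z => -1 *: z + x).
  by apply/funext => z /=; rewrite scaleN1r addrC.
exact: (measurableT_comp mF (measurable_affine_rV (-1) x)).
Qed.

Definition convol F x : R := \int[mu]_z (F (x - z) * u z).

Lemma measurable_conv F x : measurable_fun setT F ->
  measurable_fun setT (fun z => F (x - z) * u z).
Proof. by move=> mF; apply: measurable_funM => //; exact: measurable_reflect. Qed.

(** Since x sits in the kernel and not in [u], this majorant serves for continuity and, applied to
    [F'], for partial derivatives. *)
Lemma convol_dominated F (M : R) : ker 0 F -> 0 <= M ->
  exists2 C, 0 <= C & forall x z, enorm x <= M ->
    `|F (x - z) * u z| <= C * (weight z * `|u z|).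
Proof.
move=> kF M0; have [C C0 hC] := ker_bound_translate s01 m0 th0 kF M0.
by exists C => // x z xM; rewrite normrM mulrA ler_wpM2r// hC.
Qed.

Lemma integrableZ_weight_u (C : R) :
  mu.-integrable setT (fun z => (C * (weight z * `|u z|))%:E).
Proof. exact: (integrableZl measurableT C integrable_weight_u). Qed.

Lemma convol_integrable F x : ker 0 F ->
  mu.-integrable setT (EFin \o (fun z => F (x - z) * u z)).
Proof.
move=> kF; have [C C0 hC] := convol_dominated kF (enorm_ge0 x).
apply: (@le_integrable _ _ _ mu _ _ _ (fun z => (C * (weight z * `|u z|))%:E)) => //.
- apply/measurable_EFinP; apply: measurable_conv; exact: ker_measurable kF.
- move=> z _; rewrite lee_fin [leRHS]ger0_norm ?hC//.
  by rewrite !mulr_ge0 ?weight_ge0.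
- exact: integrableZ_weight_u.
Qed.

Lemma convol_is_derive F F' x (i : 'I_n) : ker 0 F -> ker 0 F' ->
  (forall y, is_derive y (delta_mx ord0 i : 'rV[R]_n) F (F' y)) ->
  is_derive x (delta_mx ord0 i : 'rV[R]_n) (convol F) (convol F' x).
Proof.
move=> kF kF' dF; set e := delta_mx ord0 i.
pose M := n%:R * (enorm e + enorm x).
have M0 : 0 <= M by rewrite mulr_ge0// addr_ge0// enorm_ge0.
have [C C0 hC] := convol_dominated kF' M0.
have hM h : -1 < h < 1 -> enorm (h *: e + x) <= M.
  move=> h1; rewrite (le_trans (enormD_le _ _))// ler_wpM2l// lerD2r enormZ.
  by rewrite ler_piMl ?enorm_ge0// ler_norml; case/andP: h1 => /ltW-> /ltW->.
apply/is_derive_line0.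
have <- : \int[mu]_z (F' (0 *: e + x - z) * u z) = convol F' x.
  by rewrite scale0r add0r.
apply: (@is_derive_Rintegral _ _ _ mu (fun h z => F (h *: e + x - z) * u z)
  (fun h z => F' (h *: e + x - z) * u z) setT 0 (-1) 1
  (fun z => C * (weight z * `|u z|))) => //.
- by rewrite ltrN10 ltr01.
- by move=> h _; exact: convol_integrable.
- move=> h z _ _.
  have -> : (fun h : R => F (h *: e + x - z) * u z) = (fun h : R => F (h *:
    e + (x - z)) * u z).
    by apply/funext => k; rewrite addrA.
  have /is_derive_line d1 := dF (h *: e + (x - z)).
  have d2 := is_deriveM d1 (is_derive_cst (u z) h (1 : R)).
  by apply: (is_derive_eq d2); rewrite scaler0 add0r /GRing.scale/= mulrC addrA.
- by move=> z; rewrite !mulr_ge0 ?weight_ge0.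
- exact: integrableZ_weight_u.
- by move=> h z hh _; apply: hC; exact: hM.
Qed.

Lemma convol_continuous F : ker 0 F -> continuous (convol F).
Proof.
move=> kF x; apply: seq_continuous_rV => w wx.
pose M := n%:R * (n%:R * 1 + enorm x).
have M0 : 0 <= M by rewrite mulr_ge0// addr_ge0// ?enorm_ge0// mulr_ge0.
have [C C0 hC] := convol_dominated kF M0.
have hM k : enorm (w k) <= M.
  rewrite -[w k](subrK x) (le_trans (enormD_le _ _))// ler_wpM2l// lerD2r.
  rewrite (le_trans (enorm_le_norm _))// ler_wpM2l// (le_trans (wx k))//.
  by rewrite invf_le1// ler1n.
have cw : w k @[k --> \oo] --> x.
  apply/cvgrPdist_le => e e0; near=> k; rewrite distrC (le_trans (wx k))//.
  rewrite invf_ple ?posrE//; apply: ltW; apply: (@le_lt_trans _ _ k%:R);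
    last by rewrite ltr_nat.
  by near: k; exact: nbhs_infty_ger.
apply: fine_cvg.
rewrite [X in _ --> X](_ : _ = \int[mu]_z (F (x - z) * u z)%:E)%E; last first.
  rewrite fineK//; apply: integrable_fin_num => //; exact: convol_integrable.
apply: (@dominated_cvg _ _ _ mu setT measurableT (fun k z => (F (w k - z) * u z)%:E)
   _ (fun z => (C * (weight z * `|u z|))%:E)) => //.
- move=> k; apply/measurable_EFinP; apply: measurable_conv; exact: ker_measurable kF.
- move=> z _; apply: cvg_EFin; first exact: nearW.
  apply: cvgM; last exact: cvg_cst.
  apply: (@continuous_cvg _ _ _ _ _ (fun k => w k - z) F (x - z)).
    exact: (ker_continuous s01 m0 kF).
  by apply: cvgB => //; exact: cvg_cst.
- exact: integrableZ_weight_u.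
- by move=> k z _; rewrite lee_fin hC.
Unshelve. all: by end_near. Qed.

(** A partial derivative of a kernel of index 0 is again one, so the induction never leaves the
    class. *)
Lemma partials_convol (l : seq 'I_n) F : ker 0 F ->
  exists2 F', ker 0 F' & partials l (convol F) = convol F'.
Proof.
move=> kF; elim: l => [|i l [F' kF' E]] /=; first by exists F.
have [F'' kF'' dF'] := ker_partial s01 m0 i kF'.
exists F'' => //; apply/funext => x; rewrite E /partial.
by have [] := convol_is_derive x kF' kF'' dF'.
Qed.

Lemma smooth_convol F : ker 0 F -> smooth_on setT (convol F).
Proof.
move=> kF l x _; have [F' kF' ->] := partials_convol l kF; split.
  exact: convol_continuous.
move=> i; have [F'' kF'' dF'] := ker_partial s01 m0 i kF'.
by have [] := convol_is_derive x kF' kF'' dF'.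
Qed.

End convolution.

(** * Smoothness as a local property *)

Section local_smooth.
Context {R : realType} {n : nat}.
Implicit Types (U : set 'rV[R]_n) (u v : 'rV[R]_n -> R).

Lemma partials_eq_on U u v (l : seq 'I_n) : open U ->
  (forall x, U x -> u x = v x) -> forall x, U x -> partials l u x = partials l v x.
Proof.
move=> oU uv; elim: l => [|i l IH]//= x Ux.
apply: near_eq_derive; near=> y; apply: IH; near: y; exact: open_nbhs_nbhs.
Unshelve. all: by end_near. Qed.

Lemma smooth_on_eq U u v : open U ->
  (forall x, U x -> u x = v x) -> smooth_on U v -> smooth_on U u.
Proof.
move=> oU uv sv l x Ux; have [cv dv] := sv l x Ux.
have E : \near x, partials l v x = partials l u x.
  by near=> y; apply/esym/(partials_eq_on l oU uv); near: y; exact: open_nbhs_nbhs.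
split=> [|i]; last exact: near_eq_derivable E (dv i).
rewrite /prop_for /continuous_at (partials_eq_on l oU uv Ux).
exact: cvg_trans (near_eq_cvg E) cv.
Unshelve. all: by end_near. Qed.

End local_smooth.

(** * The averaged mean value identity *)

Section constants.
Context {R : realType}.
Local Notation mu := (@lebesgue_measure R).

(** Half of the exponential decay of Euler's integrand is spent on the power; the other half remains
    integrable. *)
Lemma powR_le_expR_half (a : R) : 0 <= a -> exists2 C, 0 <= C &
  forall t, 0 < t -> t `^ a <= C * expR (t / 2).
Proof.
move=> a0; pose k := (Num.trunc a).+1.
(* At t/2 this polynomial is 1 + t^k, which bounds t^a both below and above t = 1 since k > a. *)
have [C C0 hC] := horner_le_expR (1 + (2 ^+ k)%:P * 'X^k : {poly R}).
exists C => // t t0; have t20 : 0 <= t / 2 by apply: divr_ge0;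
  [exact: ltW|exact: ler0n].
have := hC _ t20.
rewrite hornerD hornerC hornerM hornerC hornerXn -exprMn mulrC divfK//.
apply: le_trans; rewrite ger0_norm ?addr_ge0 ?exprn_ge0 ?(ltW t0)//.
have [t1|t1] := leP t 1.
  apply: (@le_trans _ _ 1); last by rewrite lerDl exprn_ge0// ltW.
  apply: (@le_trans _ _ (1 `^ a)); last by rewrite powR1.
  by apply: ge0_ler_powR; rewrite ?nnegrE// ltW.
apply: (@le_trans _ _ (t ^+ k)); last by rewrite lerDr.
rewrite -powR_mulrn ?(ltW t0)//; apply: ler_powR; first exact: ltW.
by apply: ltW; rewrite truncnS_gt.
Qed.

(** A real integral reads as 0 when it is infinite, so finiteness must be shown along with
    positivity; the exponential density of rate 1/2 is the majorant. *)
Lemma Gamma_gt0 (x : R) : 1 <= x -> 0 < Gamma x.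
Proof.
move=> x1; pose f (t : R) := t `^ (x - 1) * expR (- t).
pose D : set R := `]0, +oo[%classic.
have mD : measurable D by exact: measurable_itv.
have mf : measurable_fun setT f.
  apply: measurable_funM; first exact: measurable_powR.
  by apply: (measurableT_comp (@measurable_expR R)); exact: measurable_funN.
have f0 t : 0 <= f t by rewrite mulr_ge0 ?powR_ge0 ?expR_ge0.
have mfD : measurable_fun setT (f \_ D).
  by apply/(measurable_restrictT _ mD); exact: measurable_funTS.
have fD0 t : 0 <= (f \_ D) t by rewrite patchE; case: ifP.
rewrite /Gamma /Rintegral integral_mkcond -/D restrict_EFin -/f.
have pos : (0 < \int[mu]_t ((f \_ D) t)%:E)%E.
  apply: (@ge0_integral_gt0 _ _ 0 1) => // t /andP[t0 t1].
  by rewrite patchE mem_set ?mulr_gt0 ?powR_gt0 ?expR_gt0// /D/= in_itv/= t0.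
have xa : 0 <= x - 1 by rewrite subr_ge0.
have [C C0 hC] := powR_le_expR_half xa.
have half0 : 0 < 2^-1 :> R by [].
have /integrableP[mpdf ipdf] := integrable_exponential_pdf half0.
apply: fine_gt0; rewrite pos/=.
apply: (@le_lt_trans _ _ (\int[mu]_t ((2 * C)%:E * `|(EFin \o exponential_pdf 2^-1)
  t|))%E).
  apply: ge0_le_integral => //.
  - by move=> t _; rewrite lee_fin.
  - exact/measurable_EFinP.
  - by apply: measurable_funeM; exact: measurableT_comp.
  move=> t _; rewrite -EFinM lee_fin patchE; case: ifPn => [|_];
    last by rewrite mulr_ge0// mulr_ge0.
  rewrite inE /D/= in_itv/= andbT => t0.
  rewrite exponential_pdfE ?(ltW t0)// ger0_norm ?mulr_ge0 ?expR_ge0//.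
  apply: (le_trans (ler_wpM2r (expR_ge0 _) (hC t t0))).
  have -> : expR (- t) = expR (- (t / 2)) * expR (- 2^-1 * t).
    by rewrite -expRD; congr expR; field.
  have e1 : expR (t / 2) * expR (- (t / 2)) = 1 by rewrite -expRD addrN expR0.
  rewrite -mulrA (mulrA (expR _)) e1 mul1r.
  by rewrite le_eqVlt; apply/orP; left; apply/eqP; field.
rewrite ge0_integralZl//; last 2 first.
- exact: measurableT_comp.
- by rewrite lee_fin mulr_ge0.
by rewrite lte_mul_pinfty// lee_fin mulr_ge0.
Qed.

Lemma c_ns_gt0 (n : nat) (s : R) : (2 <= n)%N -> 0 < s < 1 -> 0 < c_ns n s.
Proof.
move=> n2 /andP[s0 s1]; rewrite /c_ns divr_gt0 ?powR_gt0 ?pi_gt0// mulr_gt0//.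
  by apply: sin_gt0_pi; rewrite mulr_gt0 ?pi_gt0//= gtr_pMr ?pi_gt0.
by apply: Gamma_gt0; rewrite ler_pdivlMr// mul1r ler_nat.
Qed.

End constants.

(** * Reflections and translations; integrability from a finite integral *)

Section reflect.
Context {R : realType} {n : nat}.
Local Notation mu := (lebesgue_rV R n).
Local Open Scope ereal_scope.

(** Positive and negative parts are transported separately, so the equality holds in the extended
    reals before any integrability is known. *)
Lemma integral_isometry_rV (k : R) (b : 'rV[R]_n) (f : 'rV[R]_n -> \bar R) :
  (`|k| = 1)%R -> measurable_fun setT f ->
  \int[mu]_y f (k *: y + b)%R = \int[mu]_y f y.
Proof.
move=> k1 mf; have k0 : k != 0%R by rewrite -normr_eq0 k1 oner_eq0.
have E g : measurable_fun setT g -> (forall y, 0 <= g y) ->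
    \int[mu]_y g (k *: y + b)%R = \int[mu]_y g y.
  by move=> mg g0; rewrite ge0_integral_affine_rV// k1 expr1n invr1 mul1e.
rewrite integralE [RHS]integralE; congr (_ - _).
- rewrite -(E _ (measurable_funepos mf) (funepos_ge0 f)).
  by apply: eq_integral => y _; rewrite !funeposE.
- rewrite -(E _ (measurable_funeneg mf) (funeneg_ge0 f)).
  by apply: eq_integral => y _; rewrite !funenegE.
Qed.

(** The integral is the difference of those of the two parts, and is not finite when either is
    infinite, even if both are. This extracts absolute convergence from the mean value equation. *)
Lemma fin_num_integrable d (T : measurableType d) (nu : {measure set T -> \bar R})
    (f : T -> \bar R) :
  measurable_fun setT f -> \int[nu]_x f x \is a fin_num -> nu.-integrable setT f.
Proof.
move=> mf fi; have p0 : 0 <= \int[nu]_x f^\+ x by apply: integral_ge0.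
have n0 : 0 <= \int[nu]_x f^\- x by apply: integral_ge0.
apply/integrableP; split => //.
have -> : \int[nu]_x `|f x| = \int[nu]_x f^\+ x + \int[nu]_x f^\- x.
  rewrite -ge0_integralD//; [|exact: measurable_funepos|exact: measurable_funeneg].
  by apply: eq_integral => x _; rewrite -[RHS]/((f^\+ \+ f^\-) x) -fune_abse.
move: fi p0 n0; rewrite integralE.
by case: (\int[nu]_x f^\+ x) (\int[nu]_x f^\- x) => [a||] [b||]//= _ _ _;
  rewrite -EFinD ltry.
Qed.

End reflect.

(** * Averaging the mean value property over the radius *)

Section mean_value.
Context {R : realType} {n : nat}.
Variable s : R.
Hypotheses (n2 : (2 <= n)%N) (s01 : 0 < s < 1).
Implicit Types (x y : 'rV[R]_n) (t th q : R).
Local Notation leb := (@lebesgue_measure R).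
Local Notation mu := (lebesgue_rV R n).

(** Chosen so that m - s = n/2 - 1 is the exponent of the averaging density and 2 (m + 1) = n + 2
    s. *)
Definition mexp : R := n%:R / 2 + s - 1.
Local Notation m := mexp.

Lemma mexp_ge0 : 0 <= m.
Proof.
have : 1 <= n%:R / 2 :> R by rewrite ler_pdivlMr// mul1r ler_nat.
by rewrite /mexp; case/andP: s01 => s0 _; lra.
Qed.

Lemma mexpE : 2 * (m + 1) = n%:R + 2 * s.
Proof. by rewrite /mexp; field. Qed.

Definition Phi th y : R := Tk s m bump1 (th * enorm y ^+ 2).

Lemma ker_Phi th : ker s m th 0 (Phi th).
Proof.
have := @ker_Tk R n s m th bump1 0 (@bump_bump1 R).
by rewrite (_ : m + 0%:R = m)// addr0.
Qed.

Lemma Phi_ge0 th y : 0 <= Phi th y. Proof. exact: Tk_bump1_ge0. Qed.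

(* The weight t^(n/2 - 1) times the kernel of radius sqrt t is an Abel kernel in
   the variable t. *)
Lemma A_kernel_abel (f : R -> R) t y : (t <= 0 -> f t = 0) ->
  f t * t `^ (m - s) * A_kernel s (Num.sqrt t) y =
  c_ns n s * enorm y ^- n * abel s m f (enorm y ^+ 2) t.
Proof.
move=> ft; have e0 := enorm_ge0 y.
have [t0|t0] := leP t 0.
  rewrite ft// !mul0r /abel indicE memNset ?mul0r ?mulr0//=.
  by rewrite in_itv/= ltNge t0.
have sq2 : Num.sqrt t ^+ 2 = t by rewrite sqr_sqrtr// ltW.
have lt2 : (Num.sqrt t < enorm y) = (t < enorm y ^+ 2).
  by rewrite -[in RHS]sq2 ltr_sqr ?nnegrE ?sqrtr_ge0.
rewrite /A_kernel lt2 /abel indicE; case: ifPn => ty; last first.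
  by rewrite mulr0 memNset ?mul0r ?mulr0//= in_itv/= t0/=; exact/negP.
rewrite mem_set/= ?in_itv/= ?t0// mul1r sq2.
have -> : Num.sqrt t `^ (2 * s) = t `^ s.
  by rewrite powRrM powR_mulrn ?sqrtr_ge0// sq2.
have -> : t `^ m = t `^ (m - s) * t `^ s.
  by rewrite -powRD ?(gt_eqF t0) ?implybT// subrK.
by rewrite powRN invfM; ring.
Qed.

Lemma integral_A_kernel th y : 0 < th ->
  (\int[leb]_t (bump1 (th * t) * t `^ (m - s) * A_kernel s (Num.sqrt t) y)%:E =
   (c_ns n s * Phi th y)%:E)%E.
Proof.
move=> th0; have m0 := mexp_ge0; have c0 := c_ns_gt0 n2 s01.
pose f t : R := bump1 (th * t).
have ft t : t <= 0 -> f t = 0.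
  move=> t0; apply: (bump_eq0 (@bump_bump1 R)); left.
  by rewrite (le_trans _ ler01)// mulr_ge0_le0// ltW.
have mf : measurable_fun setT f.
  by apply: (measurableT_comp (@measurable_bump1 R)); exact: measurable_funM.
have f0 t : 0 <= f t by exact: bump1_ge0.
transitivity (\int[leb]_t ((c_ns n s * enorm y ^- n)%:E * (abel s m f (enorm y ^+ 2)
  t)%:E))%E.
  by apply: eq_integral => t _; rewrite -EFinM -(A_kernel_abel _ (ft t)).
have cn0 : 0 <= c_ns n s * enorm y ^- n.
  by rewrite mulr_ge0 ?invr_ge0 ?exprn_ge0 ?enorm_ge0// ltW.
rewrite ge0_integralZl//; last 2 first.
- by apply/measurable_EFinP; exact: measurable_abel.
- by move=> t _; rewrite lee_fin abel_ge0.
(* At the origin the prefactor is only a default value, but the Abel integral and [Phi] both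
   vanish. *)
have [y0|y0] := eqVneq (enorm y) 0.
  have y1 : th * enorm y ^+ 2 <= 1 by rewrite y0 expr0n mulr0.
  rewrite /Phi (Tk_eq0 _ _ (@bump_bump1 R) y1) mulr0.
  rewrite [X in (_ * X)%E](_ : _ = 0%E) ?mule0//.
  apply: integral0_eq => t _; rewrite /abel y0 expr0n indicE memNset ?mul0r//=.
  by rewrite in_itv/= => /andP[/lt_trans h /h]; rewrite ltxx.
have e0 : 0 < enorm y by rewrite lt_neqAle eq_sym y0 enorm_ge0.
have q0 : 0 < enorm y ^+ 2 by rewrite exprn_gt0.
rewrite integral_abel//.
have -> : (\int[leb]_(t in `]0%R, 1%R[) (f (enorm y ^+ 2 * t) * wt s m t)%:E =
   (Phi th y)%:E)%E.
  rewrite /Phi /Tk /Rintegral fineK//.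
    by apply: eq_integral => t _; rewrite /f mulrA.
  apply: integrable_fin_num => //; apply: integrable_Tk => //; exact: bump_bump1.
rewrite -!EFinM; congr EFin.
(* Here 1 + m - s = n/2, so the power produced by rescaling cancels that of the kernel. *)
have -> : (enorm y ^+ 2) `^ (1 + m - s) = enorm y ^+ n.
  rewrite -powR_mulrn ?(ltW e0)// -powRrM -powR_mulrn ?(ltW e0)//.
  by congr (_ `^ _); rewrite /mexp; field.
by rewrite mulrA -(mulrA (c_ns n s)) mulVf ?mulr1// expf_neq0.
Qed.

Variable u : 'rV[R]_n -> R.
Hypothesis uLs : Ls s u.

Let mu_ : measurable_fun setT u. Proof. by case: uLs. Qed.

Lemma Ls_weight : (\int[mu]_z (weight m z * `|u z|)%:E < +oo)%E.
Proof.
case: uLs => _; under eq_integral do rewrite mulrC.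
by rewrite /weight mexpE.
Qed.

Lemma integrable_Phi_u th x : 0 < th ->
  mu.-integrable setT (fun y => (Phi th y * u (x - y))%:E).
Proof.
move=> th0; have m0 := mexp_ge0.
have := convol_integrable s01 m0 th0 mu_ Ls_weight x (ker_Phi th).
have mPhi := ker_measurable s01 m0 (ker_Phi th).
move=> /integrableP[m1 i1]; apply/integrableP; split.
  by apply/measurable_EFinP; apply: measurable_funM => //; exact: measurable_reflect.
rewrite -(@integral_isometry_rV R n (-1) x) ?normrN1//; last first.
  apply: measurableT_comp => //; apply/measurable_EFinP; apply: measurable_funM => //.
  exact: measurable_reflect.
apply: le_lt_trans i1; rewrite le_eqVlt; apply/orP; left; apply/eqP.
apply: eq_integral => z _; rewrite /= scaleN1r (addrC (- z)).
by rewrite (_ : x - (x - z) = z)// subKr.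
Qed.

Lemma convolE th x : 0 < th ->
  (convol u (Phi th) x)%:E = (\int[mu]_y (Phi th y * u (x - y))%:E)%E.
Proof.
move=> th0; have m0 := mexp_ge0.
have mPhi := ker_measurable s01 m0 (ker_Phi th).
have := convol_integrable s01 m0 th0 mu_ Ls_weight x (ker_Phi th) => iP.
rewrite /convol /Rintegral fineK; last exact: integrable_fin_num.
rewrite -[RHS](@integral_isometry_rV R n (-1) x) ?normrN1//; last first.
  apply/measurable_EFinP; apply: measurable_funM => //; exact: measurable_reflect.
apply: eq_integral => z _; rewrite /= scaleN1r (addrC (- z)).
by rewrite (_ : x - (x - z) = z)// subKr.
Qed.

Lemma measurable_A_kernel :
  measurable_fun setT (fun p : measurableTypeR R * 'rV[R]_n =>
    A_kernel s (Num.sqrt p.1) p.2).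
Proof.
have ms : measurable_fun setT (fun p : measurableTypeR R * 'rV[R]_n => Num.sqrt p.1).
  by apply: (measurableT_comp (continuous_measurable_fun (@sqrt_continuous R))).
have me : measurable_fun setT (fun p : measurableTypeR R * 'rV[R]_n => enorm p.2).
  by apply: (measurableT_comp measurable_enorm).
apply: measurable_fun_ifT => //; first exact: measurable_fun_ltr.
apply: measurable_funM => //; apply: measurable_funM.
  exact: (measurableT_comp (measurable_powR (2 * s)) ms).
apply: measurable_funV_ge0.
  by move=> p; rewrite mulr_ge0 ?powR_ge0// exprn_ge0// enorm_ge0.
apply: measurable_funM; last exact: measurable_funX.
apply: (measurableT_comp (measurable_powR s)).
by apply: measurable_funB; exact: measurable_funX.
Qed.

(** The double integral of psi(th t) t^(n/2 - 1) A_r(y) u(x - y), with r^2 = t, is computed twice: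
    in y first by the mean value property, in t first by [integral_A_kernel]. *)
Lemma mean_convol th x : 0 < th ->
  (forall r, 0 < r -> r < Num.sqrt (2 / th) -> (u x)%:E = A_star s r u x) ->
  u x * (th `^ (- (n%:R / 2)) * mom (m - s)) = c_ns n s * convol u (Phi th) x.
Proof.
move=> th0 umean; have m0 := mexp_ge0; have c0 := c_ns_gt0 n2 s01.
pose B (p : measurableTypeR R * 'rV[R]_n) : R :=
  bump1 (th * p.1) * p.1 `^ (m - s) * A_kernel s (Num.sqrt p.1) p.2.
have B0 p : 0 <= B p.
  apply: mulr_ge0; first by apply: mulr_ge0; rewrite ?bump1_ge0 ?powR_ge0.
  rewrite /A_kernel; case: ifP => // h.
  rewrite mulr_ge0 ?(ltW c0)// divr_ge0 ?powR_ge0// mulr_ge0 ?powR_ge0//.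
  by rewrite exprn_ge0 ?enorm_ge0.
have mA := measurable_A_kernel.
have mB : measurable_fun setT B.
  apply: measurable_funM => //; apply: measurable_funM.
    apply: (measurableT_comp (@measurable_bump1 R)); exact: measurable_funM.
  by apply: (measurableT_comp (measurable_powR (m - s))).
have mux : measurable_fun setT (fun y => u (x - y)) by exact: measurable_reflect.
pose F (p : measurableTypeR R * 'rV[R]_n) : \bar R := (B p * u (x - p.2))%:E.
have mF : measurable_fun setT F.
  apply/measurable_EFinP; apply: measurable_funM => //.
  exact: (measurableT_comp mux measurable_snd).
(* Absolute convergence is tested with t first, because the nonnegative kernel then averages to
   [Phi]. *)
have innert y : (\int[leb]_t `|F (t, y)| = (c_ns n s)%:E * `|(Phi th y * u (x -
  y))%:E|)%E.
  transitivity (\int[leb]_t (`|u (x - y)|%R%:E * (B (t, y))%:E))%E.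
    by apply: eq_integral => t _; rewrite /F /= normrM (ger0_norm (B0 _)) mulrC EFinM.
  rewrite ge0_integralZl//=; last 2 first.
  - by apply/measurable_EFinP; exact: measurable_fun_pair1.
  - by move=> t _; rewrite lee_fin.
  rewrite [X in (_ * X)%E](integral_A_kernel y th0) -!EFinM; congr EFin.
  by rewrite normrM (ger0_norm (Phi_ge0 _ _)); ring.
have iF : (leb \x mu)%E.-integrable setT F.
  apply/integrable21ltyP => //.
  under eq_integral do rewrite innert.
  have /integrableP[mP iP] := integrable_Phi_u x th0.
  rewrite ge0_integralZl//; last 2 first.
  - exact: measurableT_comp.
  - by rewrite lee_fin ltW.
  by rewrite lte_mul_pinfty ?lee_fin// ltW.
have := Fubini iF.
have -> : (\int[leb]_t \int[mu]_y F (t, y) =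
    (u x * (th `^ (- (n%:R / 2)) * mom (m - s)))%:E)%E.
  have us : -1 * (m - s) - 1 = - (n%:R / 2) by rewrite /mexp; ring.
  transitivity (\int[leb]_t ((u x)%:E * (bump1 (th * t) * t `^ (m - s))%:E))%E.
    apply: eq_integral => t _; rewrite /F /B /=.
    (* The bump confines t to 1/th < t < 2/th, so only radii below sqrt (2/th) occur. *)
    have [t1|t1] := boolP (1 < th * t < 2); last first.
      have b0 : bump1 (th * t) = 0.
        apply: (bump_eq0 (@bump_bump1 R)).
        by move: t1; rewrite negb_and -!leNgt => /orP[]; [left|right].
      rewrite b0 !mul0r mule0; apply: integral0_eq => y _; by rewrite !mul0r.
    case/andP: t1 => t1 t2.
    have t0 : 0 < t by rewrite -(pmulr_rgt0 _ th0) (lt_trans _ t1).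
    have us_ : (u x)%:E = A_star s (Num.sqrt t) u x.
      apply: umean; first by rewrite sqrtr_gt0.
      rewrite ltr_sqrt; last by rewrite divr_gt0.
      by rewrite ltr_pdivlMr// mulrC.
    have mAu : measurable_fun setT (fun y => (A_kernel s (Num.sqrt t) y * u (x -
      y))%:E).
      apply/measurable_EFinP; apply: measurable_funM => //.
      exact: (measurable_fun_pair2 t mA).
    (* The finite value u(x) of the integral forces absolute convergence, which allows scalars to be
       moved inside. *)
    have iAu := fin_num_integrable mAu.
    rewrite /A_star in us_.
    have /iAu iAu' : (\int[mu]_y (A_kernel s (Num.sqrt t) y * u (x - y))%:E)%E \is a
      fin_num.
      by rewrite -us_.
    rewrite us_ -muleC -integralZl//; apply: eq_integral => y _.
    by rewrite -EFinM mulrA.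
  have mb : measurable_fun setT (fun t : R => bump1 (th * t) * t `^ (m - s)).
    apply: measurable_funM; last exact: measurable_powR.
    by apply: (measurableT_comp (@measurable_bump1 R)); exact: measurable_funM.
  have mbE : measurable_fun setT (fun t : measurableTypeR R =>
    (bump1 (th * t) * t `^ (m - s))%:E).
    exact/measurable_EFinP.
  have momE' : (\int[leb]_t (bump1 (th * t) * t `^ (m - s))%:E =
      (th `^ (- (n%:R / 2)) * mom (m - s))%:E)%E.
    by rewrite mom_scale//; congr (_ `^ _ * _)%:E; rewrite -us; ring.
  rewrite integralZl//; first by rewrite [X in (_ * X)%E]momE'.
  by apply: fin_num_integrable => //; rewrite momE'.
move=> H; apply: EFin_inj; rewrite H EFinM convolE//.
have iB y : leb.-integrable setT (fun t => (B (t, y))%:E).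
  apply: fin_num_integrable; last by rewrite (integral_A_kernel y th0).
  by apply/measurable_EFinP; exact: measurable_fun_pair1.
rewrite -integralZl//; last exact: integrable_Phi_u.
apply: eq_integral => y _.
transitivity (\int[leb]_t ((u (x - y))%:E * (B (t, y))%:E))%E.
  by apply: eq_integral => t _; rewrite /F /= -EFinM mulrC.
rewrite integralZl// [X in (_ * X)%E](integral_A_kernel y th0) -!EFinM; congr EFin.
by ring.
Qed.

(** [Phi th] is [Phi 1] composed with the dilation of ratio sqrt th. *)
Lemma integral_Phi_scale th : 0 < th ->
  (\int[mu]_y (Phi th y)%:E =
   (th `^ (- (n%:R / 2)))%:E * \int[mu]_y (Phi 1 y)%:E)%E.
Proof.
move=> th0; have m0 := mexp_ge0.
have mP := ker_measurable s01 m0 (ker_Phi 1).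
have mPhi : measurable_fun setT (fun y => (Phi 1 y)%:E) by exact/measurable_EFinP.
have st0 : 0 < Num.sqrt th by rewrite sqrtr_gt0.
have st0' : Num.sqrt th != 0 by rewrite gt_eqF.
have h0 y : (0 <= (Phi 1 y)%:E)%E by rewrite lee_fin Phi_ge0.
have := ge0_integral_affine_rV 0 st0' mPhi h0.
rewrite gtr0_norm// (_ : Num.sqrt th ^- n = th `^ (- (n%:R / 2))); last first.
  rewrite powRN; congr (_^-1); rewrite -powR_mulrn ?sqrtr_ge0//.
  by rewrite -powR12_sqrt ?(ltW th0)// -powRrM mulrC.
move=> <-; apply: eq_integral => y _; rewrite addr0 /Phi enormZ gtr0_norm//.
by rewrite mul1r exprMn (sqr_sqrtr (ltW th0)).
Qed.

Lemma integral_Phi_lty th : 0 < th -> (\int[mu]_y (Phi th y)%:E < +oo)%E.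
Proof.
move=> th0; have m0 := mexp_ge0.
have [C C0 hC] := ker_bound s01 m0 th0 (ker_Phi th).
have np : n%:R < 2 * (m + 1) by rewrite mexpE; case/andP: s01; lra.
have mw := @measurable_weight R n m.
have mP := ker_measurable s01 m0 (ker_Phi th).
apply: (@le_lt_trans _ _ (\int[mu]_y (C%:E * (weight m y)%:E))%E).
  apply: ge0_le_integral => //.
  - by move=> y _; rewrite lee_fin Phi_ge0.
  - exact/measurable_EFinP.
  - by apply: measurable_funeM; exact/measurable_EFinP.
  move=> y _; rewrite -EFinM lee_fin ler_pdivlMr; last first.
    by rewrite ltr_wpDr ?powR_ge0.
  by have := hC y; rewrite expr0 mul1r; apply: le_trans; rewrite ger0_norm// Phi_ge0.
rewrite ge0_integralZl//; last 2 first.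
- exact/measurable_EFinP.
- by move=> y _; rewrite lee_fin weight_ge0.
by rewrite lte_mul_pinfty ?lee_fin// integral_weight.
Qed.

End mean_value.

(** * Second differences *)

(** The increment may have either sign, as the coordinates of a vector do. *)
Lemma MVT0 (R : realType) (f f' : R -> R) (a : R) :
  (forall t : R, is_derive t 1 f (f' t)) ->
  exists2 t, `|t| <= `|a| & f a - f 0 = f' t * a.
Proof.
move=> df.
have cf b c : {within `[b, c], continuous f}.
  by apply: derivable_within_continuous => t _; have [] := df t.
have [a0|a0|->] := ltgtP a 0; last by exists 0 => //; rewrite subrr mulr0.
- have [t] := MVT a0 (fun t _ => df t) (cf a 0).
  rewrite in_itv/= => /andP[at_ t0] E; exists t.
    by rewrite !ltr0_norm// lerN2 ltW.
  by rewrite -opprB E sub0r mulrN opprK.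
- have [t] := MVT a0 (fun t _ => df t) (cf 0 a).
  rewrite in_itv/= => /andP[t0 ta] E; exists t; last by rewrite E subr0.
  by rewrite !gtr0_norm// ltW.
Qed.

Section second_difference.
Context {R : realType} {n : nat}.
Implicit Types (x y z : 'rV[R]_n) (u : 'rV[R]_n -> R).

(** The vertices of a path from 0 to [y] along the axes. The C^1 condition is given through partial
    derivatives, so increments of [u] are telescoped along this path. *)
Definition trunc_rV (k : nat) y : 'rV[R]_n := \row_j (if (j < k)%N then y ord0 j else
  0).

Lemma trunc_rV0 y : trunc_rV 0 y = 0.
Proof. by apply/rowP => j; rewrite !mxE. Qed.

Lemma trunc_rV_full y : trunc_rV n y = y.
Proof. by apply/rowP => j; rewrite !mxE ltn_ord. Qed.

Lemma trunc_rVS (k : 'I_n) y :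
  trunc_rV k.+1 y = y ord0 k *: delta_mx ord0 k + trunc_rV k y.
Proof.
apply/rowP => j; rewrite !mxE eqxx /=; have [->|jk] := eqVneq j k.
  by rewrite ltnS leqnn ltnn mulr1 addr0.
rewrite mulr0 add0r ltnS leq_eqVlt; case: eqP => // /val_inj jk'.
by rewrite jk' eqxx in jk.
Qed.

Lemma enorm_le_coord x y : (forall j, `|x ord0 j| <= `|y ord0 j|) -> enorm x <= enorm y.
Proof.
move=> h; rewrite ler_wsqrtr// ler_sum// => j _.
by rewrite -(real_normK (num_real (x ord0 j))) -(real_normK (num_real (y ord0 j)))
  ler_sqr ?nnegrE.
Qed.

Lemma compact_unit_ball x : compact [set z : 'rV[R]_n | `|z - x| <= 1].
Proof.
rewrite (_ : [set z | _] = [set z : 'rV[R]_n |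
    forall i, `[x ord0 i - 1, x ord0 i + 1]%classic (z ord0 i)]).
  apply: (@rV_compact R n (fun i => `[x ord0 i - 1, x ord0 i + 1]%classic)) => i.
  exact: segment_compact.
apply/seteqP; split => z /=.
  move=> zx i; rewrite in_itv/= -ler_distlC distrC.
  by have := coord_le_norm (z - x) i; rewrite !mxE => /le_trans; apply.
move=> h; apply: norm_le_coord => // i.
by have := h i; rewrite in_itv/= -ler_distlC distrC !mxE.
Qed.

(** In this case each of the two first differences already has the right order. *)
Lemma holder_second_diff (a : R) u x : holder_loc a u ->
  exists2 C, 0 <= C & forall y, enorm y <= 1 ->
    `|2 * u x - u (x + y) - u (x - y)| <= C * enorm y `^ a.
Proof.
move=> /(_ _ (@compact_unit_ball x))[C hC]; exists (2 * `|C|) => [|y y1].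
  by rewrite mulr_ge0.
have K0 : `|x - x| <= 1 by rewrite subrr normr0.
have H z : enorm z = enorm y -> `|u x - u (x + z)| <= `|C| * enorm y `^ a.
  move=> zy; have Kz : `|x + z - x| <= 1.
    by rewrite addrC addKr (le_trans (norm_le_enorm _))// zy.
  apply: (le_trans (hC x (x + z) K0 Kz)).
  by rewrite opprD addNKr enormN zy ler_wpM2r ?powR_ge0// ler_norm.
have -> : 2 * u x - u (x + y) - u (x - y) = (u x - u (x + y)) + (u x - u (x - y)) by
  ring.
rewrite (le_trans (ler_normD _ _))// mulrDl mul1r mulrDl lerD// H// enormN//.
Qed.

(** The linear part is odd and cancels between y and -y; the mean value theorem on each axis segment
    leaves a Hölder remainder. *)
Lemma holder1_second_diff (a : R) u x : 0 <= a -> holder1_loc a u ->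
  exists2 C, 0 <= C & forall y, enorm y <= 1 ->
    `|2 * u x - u (x + y) - u (x - y)| <= C * enorm y `^ (1 + a).
Proof.
move=> a0 hu.
have H i : exists C, forall z z', `|z - x| <= 1 -> `|z' - x| <= 1 ->
    `|partial i u z - partial i u z'| <= C * enorm (z - z') `^ a.
  exact: (hu i).2 _ (@compact_unit_ball x).
move/choice : H => [C hC].
pose D := \sum_(i < n) `|C i|.
have D0 : 0 <= D by apply: sumr_ge0.
pose L y := \sum_(i < n) partial i u x * y ord0 i.
have E y : enorm y <= 1 -> `|u (x + y) - u x - L y| <= D * enorm y `^ (1 + a).
  move=> y1.
  have -> : u (x + y) - u x =
      \sum_(k < n) (u (trunc_rV k.+1 y + x) - u (trunc_rV k y + x)).
    rewrite -(big_mkord xpredT (fun k => u (trunc_rV k.+1 y + x) - u (trunc_rV k y +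
      x))).
    by rewrite telescope_sumr// trunc_rV0 trunc_rV_full add0r (addrC y).
  rewrite /L -sumrB (le_trans (ler_norm_sum _ _ _))// mulr_suml ler_sum// => k _.
  have dk (t : R) : is_derive t 1 (fun h : R => u (h *:
    delta_mx ord0 k + (trunc_rV k y + x)))
      (partial k u (t *: delta_mx ord0 k + (trunc_rV k y + x))).
    by apply/is_derive_line; split => //; exact: (hu k).1.
  have [t ty] := MVT0 (y ord0 k) dk.
  rewrite scale0r add0r addrA -trunc_rVS => ->.
  rewrite -mulrBl normrM.
  set xi := t *: _ + _.
  (* Coordinate by coordinate, the intermediate point is no farther from [x] than [x + y] is. *)
  have xix : enorm (xi - x) <= enorm y.
    apply: enorm_le_coord => j; rewrite /xi addrA addrK !mxE eqxx/=.
    have [->|jk] := eqVneq j k; first by rewrite ltnn addr0 mulr1.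
    by rewrite mulr0 add0r; case: ifP => // _; rewrite normr0.
  have K0 : `|x - x| <= 1 by rewrite subrr normr0.
  have Kxi : `|xi - x| <= 1 by rewrite (le_trans (norm_le_enorm _))// (le_trans xix).
  have y0 := enorm_ge0 y.
  have -> : enorm y `^ (1 + a) = enorm y `^ a * enorm y.
    have [->|yn0] := eqVneq (enorm y) 0.
      by rewrite mulr0 powR0// gt_eqF// ltr_wpDr.
    by rewrite addrC powRD ?yn0 ?implybT// powRr1.
  rewrite mulrA ler_pM ?coord_le_enorm//.
  apply: (le_trans (hC k _ _ Kxi K0)).
  apply: (@le_trans _ _ (`|C k| * enorm (xi - x) `^ a)).
    by rewrite ler_wpM2r ?powR_ge0// ler_norm.
  by rewrite ler_wpM2l//; apply: ge0_ler_powR; rewrite ?nnegrE ?enorm_ge0.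
exists (2 * D) => [|y y1]; first by rewrite mulr_ge0.
have E1 := E y y1; have := E (- y); rewrite enormN => /(_ y1) E2.
have LN : L (- y) = - L y.
  by rewrite /L -sumrN; apply: eq_bigr => i _; rewrite mxE mulrN.
have -> : 2 * u x - u (x + y) - u (x - y) =
   - ((u (x + y) - u x - L y) + (u (x - y) - u x - L (- y))) by rewrite LN; ring.
by rewrite normrN (le_trans (ler_normD _ _))// mulrDl mul1r mulrDl lerD.
Qed.

End second_difference.

(** * The fractional Laplacian and smoothness *)

Lemma C2s_second_diff (R : realType) n (s eps : R) (u : 'rV[R]_n -> R) x :
  small_eps s eps -> 0 < s -> C2s_loc s eps u ->
  exists2 C, 0 <= C & forall y, enorm y <= 1 ->
    `|2 * u x - u (x + y) - u (x - y)| <= C * enorm y `^ (2 * s + eps).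
Proof.
move=> [/andP[e0 e1] _] s0; rewrite /C2s_loc; case: ltP => hs hu.
  exact: holder_second_diff hu.
have a0 : 0 <= 2 * s + eps - 1.
  have : 2 * 2^-1 <= 2 * s by rewrite ler_pM2l.
  by rewrite mulfV//; lra.
have [C C0 hC] := holder1_second_diff x a0 hu.
by exists C => // y /hC; rewrite addrCA addrN addr0.
Qed.

(** Smoothness needs one bound on the radii for all points near [x]. Half of the sup-norm radius e
    is spent on moving the point; the other half bounds the distance to the boundary, since boundary
    points lie outside the open set and the sup norm is at most the Euclidean one. *)
Lemma dist_boundary (R : realType) n (Omega : set 'rV[R]_n) x : open Omega -> Omega x ->
  exists2 d : R, 0 < d & forall x', `|x - x'| < d ->
    Omega x' /\ forall r, r < d -> (r%:E < edist_set x' (boundary Omega))%E.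
Proof.
move=> oO Ox; have : nbhs x Omega by exact: open_nbhs_nbhs.
move=> /nbhs_ballP[e /= e0 eO].
have hO z : `|x - z| < e -> Omega z by move=> xz; apply: eO; rewrite -ball_normE.
exists (e / 2) => [|x' xx']; first by rewrite divr_gt0.
split=> [|r rd]; first by apply: hO; rewrite (lt_trans xx')// ltr_pdivrMr//; lra.
apply: (@lt_le_trans _ _ (e / 2)%:E); first by rewrite lte_fin.
apply: le_ereal_inf_tmp => _ [z [_ nz] <-]; rewrite lee_fin.
have {nz} xz : e <= `|x - z|.
  by rewrite leNgt; apply/negP => /hO Oz; apply: nz; exact: open_nbhs_nbhs.
rewrite (le_trans _ (norm_le_enorm _))//.
have := ler_normD (x - x') (x' - z); rewrite addrA subrK.
by move: xx' xz; lra.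
Qed.

Section final.
Context {R : realType} {n : nat}.
Variable s : R.
Hypotheses (n2 : (2 <= n)%N) (s01 : 0 < s < 1).
Implicit Types (x y : 'rV[R]_n) (t th q : R).
Local Notation mu := (lebesgue_rV R n).
Local Notation m := (@mexp R n s).
Variable u : 'rV[R]_n -> R.
Hypothesis uLs : Ls s u.
Let mu_ : measurable_fun setT u. Proof. by case: uLs. Qed.
Let m0 : 0 <= m. Proof. exact: mexp_ge0. Qed.
Let s0 : 0 < s. Proof. by case/andP: s01. Qed.

(** The signs k = 1 and k = -1 treat u(x + y) and u(x - y) at once. *)
Lemma weight_reflect_lty (k : R) x : `|k| = 1 ->
  (\int[mu]_y (weight m y * `|u (k *: y + x)|)%:E < +oo)%E.
Proof.
move=> k1; have kk : k * k = 1.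
  by rewrite -expr2 -(real_normK (num_real k)) k1 expr1n.
have p0 : 0 <= 2 * (m + 1) by rewrite mulr_ge0// addr_ge0.
have [C C0 hC] := @weight_translate R n _ _ p0 (enorm_ge0 x).
have mw := @measurable_weight R n m.
have mG : measurable_fun setT (fun y => (weight m y * `|u (k *: y + x)|)%:E).
  apply/measurable_EFinP; apply: measurable_funM => //.
  by apply: measurableT_comp => //; exact: (measurableT_comp mu_ (measurable_affine_rV
    k x)).
rewrite -(integral_isometry_rV (- (k *: x)) k1 mG).
apply: (@le_lt_trans _ _ (\int[mu]_z (C%:E * (weight m z * `|u z|)%:E))%E).
  have mwu : measurable_fun setT (fun z => (weight m z * `|u z|)%:E).
    by apply/measurable_EFinP; apply: measurable_funM => //; exact: measurableT_comp.
  apply: ge0_le_integral => //.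
  - by move=> z _; rewrite lee_fin mulr_ge0 ?weight_ge0.
  - exact: (measurableT_comp mG (measurable_affine_rV k (- (k *: x)))).
  - exact: measurable_funeM.
  move=> z _; rewrite -EFinM lee_fin mulrA.
  have -> : k *: (k *: z - k *: x) + x = z.
    by rewrite -scalerBr scalerA kk scale1r subrK.
  rewrite ler_wpM2r// /weight -scalerBr enormZ k1 mul1r.
  have -> : enorm (z - x) = enorm (x - z) by rewrite -enormN opprB.
  have w1 z' : 0 < 1 + enorm z' `^ (2 * (m + 1)) :> R by rewrite ltr_wpDr// powR_ge0.
  by rewrite ler_pdivlMr// mulrC ler_pdivrMr// hC.
rewrite ge0_integralZl//.
- by rewrite lte_mul_pinfty ?lee_fin ?(ltW C0)//; exact: Ls_weight.
- by apply/measurable_EFinP; apply: measurable_funM => //; exact: measurableT_comp.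
- by move=> z _; rewrite lee_fin mulr_ge0 ?weight_ge0.
- by rewrite lee_fin ltW.
Qed.

Lemma measurable_second_diff x :
  measurable_fun setT (fun y => 2 * u x - u (x + y) - u (x - y)).
Proof.
apply: measurable_funB; last exact: measurable_reflect.
apply: measurable_funB => //.
have := measurableT_comp mu_ (measurable_affine_rV 1 x).
by rewrite (_ : u \o _ = fun y => u (x + y))//; apply/funext => y /=;
  rewrite scale1r addrC.
Qed.

Lemma integrable_second_diff (eps : R) x : small_eps s eps -> C2s_loc s eps u ->
  mu.-integrable setT (fun y =>
    ((2 * u x - u (x + y) - u (x - y)) / enorm y `^ (n%:R + 2 * s))%:E).
Proof.
move=> se uC; have [C C0 hC] := C2s_second_diff x se s0 uC.
have [/andP[e0 e1] _] := se.
have mw : measurable_fun setT (weight m) := @measurable_weight R n m.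
have muk k : measurable_fun setT (fun y => u (k *: y + x)).
  exact: (measurableT_comp mu_ (measurable_affine_rV k x)).
(* Inside the unit ball the Hölder bound divided by |y|^(n + 2 s) leaves |y|^-(n - eps). Outside,
   the kernel is at most twice the weight, and [D1] and [D2] bound the three values of [u]
   separately. *)
pose D0 y := C * (\1_(eball 1) y * enorm y `^ (- (n%:R - eps))).
pose D1 y := (4 * `|u x|) * weight m y.
pose D2 k y := 2 * (weight m y * `|u (k *: y + x)|).
have mkint (c : R) (f : 'rV[R]_n -> R) : measurable_fun setT f -> (forall y,
  0 <= f y) ->
    (\int[mu]_y (f y)%:E < +oo)%E -> mu.-integrable setT (fun y => (c * f y)%:E).
  move=> mf f0 fi.
  have iF : mu.-integrable setT (fun y => (f y)%:E).
    apply/integrableP; split; first exact/measurable_EFinP.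
    by under eq_integral do rewrite gee0_abs ?lee_fin//.
  exact: (integrableZl measurableT c iF).
have np : n%:R < 2 * (m + 1) by rewrite mexpE ltrDl mulr_gt0.
have iD0 : mu.-integrable setT (fun y => (D0 y)%:E).
  apply: mkint.
  - apply: measurable_funM; first exact: measurable_indic_eball.
    exact: measurable_powR_enorm.
  - by move=> y; rewrite mulr_ge0// powR_ge0.
  - apply: integral_enorm_near0; apply/andP; split; last by rewrite ltrBlDr ltrDl.
    by rewrite subr_gt0 (lt_trans e1)// ltr1n.
have iD1 : mu.-integrable setT (fun y => (D1 y)%:E).
  apply: mkint => //; first by move=> y; exact: weight_ge0.
  exact: integral_weight.
have iD2 k : `|k| = 1 -> mu.-integrable setT (fun y => (D2 k y)%:E).
  move=> k1; apply: mkint.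
  - by apply: measurable_funM => //; exact: measurableT_comp.
  - by move=> y; rewrite mulr_ge0 ?weight_ge0.
  - exact: weight_reflect_lty.
pose D y := (D0 y)%:E + (D1 y)%:E + ((D2 1 y)%:E + (D2 (-1) y)%:E).
have iD : mu.-integrable setT D.
  apply: integrableD => //; first exact: integrableD.
  by apply: integrableD => //; apply: iD2; rewrite ?normrN normr1.
have mg : measurable_fun setT (fun y =>
    (2 * u x - u (x + y) - u (x - y)) / enorm y `^ (n%:R + 2 * s)).
  apply: measurable_funM; first exact: measurable_second_diff.
  apply: measurable_funV_ge0; [by move=> y; exact: powR_ge0|exact:
    measurable_powR_enorm].
apply: (@le_integrable _ _ _ mu _ _ _ D) => //; first exact/measurable_EFinP.
move=> y _; rewrite /D -!EFinD lee_fin.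
have D00 : 0 <= D0 y by rewrite mulr_ge0// mulr_ge0// powR_ge0.
have D10 : 0 <= D1 y by rewrite mulr_ge0 ?weight_ge0// mulr_ge0.
have D20 k : 0 <= D2 k y by rewrite mulr_ge0// mulr_ge0 ?weight_ge0.
rewrite [leRHS]ger0_norm ?addr_ge0//.
rewrite normrM normfV (ger0_norm (powR_ge0 _ _)).
have [y0|y0] := eqVneq (enorm y) 0.
  have yE : y = 0 by apply/eqP; rewrite -enorm_eq0 y0.
  have -> : 2 * u x - u (x + y) - u (x - y) = 0 by rewrite yE addr0 subr0; ring.
  by rewrite normr0 mul0r !addr_ge0.
have ey : 0 < enorm y by rewrite lt_neqAle eq_sym y0 enorm_ge0.
have [y1|y1] := leP (enorm y) 1.
  apply: (@le_trans _ _ (D0 y)); last first.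
    by rewrite -addrA lerDl !addr_ge0.
  rewrite /D0 indicE mem_set// mul1r ler_pdivrMr ?powR_gt0//.
  rewrite -mulrA -powRD ?y0 ?implybT//.
  by rewrite (_ : - (n%:R - eps) + (n%:R + 2 * s) = 2 * s + eps) ?hC//; ring.
apply: (@le_trans _ _ (D1 y + (D2 1 y + D2 (-1) y))); last by rewrite -addrA lerDr.
have pw : (enorm y `^ (n%:R + 2 * s))^-1 <= 2 * weight m y.
  rewrite /weight mexpE.
  have P1 : 1 <= enorm y `^ (n%:R + 2 * s).
    have : (1 : R) = 1 `^ (n%:R + 2 * s) by rewrite powR1.
    move=> {1}->; apply: ge0_ler_powR; rewrite ?nnegrE ?(ltW ey) ?(ltW y1)//.
    by rewrite addr_ge0// mulr_ge0// ltW.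
  rewrite ler_pdivlMr ?ltr_wpDr ?powR_ge0// mulrC ler_pdivrMr ?powR_gt0//.
  by lra.
apply: (@le_trans _ _ ((2 * `|u x| + `|u (x + y)| + `|u (x - y)|) * (2 * weight m y))).
  rewrite ler_pM ?invr_ge0 ?powR_ge0//.
  rewrite (le_trans (ler_normB _ _))// lerD2r (le_trans (ler_normB _ _))// lerD2r.
  by rewrite normrM ger0_norm.
rewrite /D1 /D2 scale1r scaleN1r (addrC y x) (addrC (- y) x).
by rewrite le_eqVlt; apply/orP; left; apply/eqP; ring.
Qed.

(** The powers of th in [Tk_bound] cancel exactly, so the kernel of the fractional Laplacian is a
    majorant uniform in th. *)
Lemma scaled_Phi_bound : exists2 C, 0 <= C & forall th y, 0 < th ->
  th `^ (m + 1) * Phi s th y <= C / enorm y `^ (n%:R + 2 * s).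
Proof.
have [C C0 hC] := Tk_bound s01 m0 (@bump_bump1 R).
exists C => // th y th0; have [y0|y0] := eqVneq (enorm y) 0.
  have q1 : th * enorm y ^+ 2 <= 1 by rewrite y0 expr0n mulr0.
  by rewrite /Phi (Tk_eq0 _ _ (@bump_bump1 R) q1) mulr0 divr_ge0 ?powR_ge0.
have ey : 0 < enorm y by rewrite lt_neqAle eq_sym y0 enorm_ge0.
have q0 : 0 < th * enorm y ^+ 2 by rewrite mulr_gt0// exprn_gt0.
have := hC _ q0; rewrite ger0_norm ?Tk_bump1_ge0// -/(Phi s th y) => h.
apply: (le_trans (ler_wpM2l (powR_ge0 th _) h)).
rewrite powRM ?(ltW th0) ?sqr_ge0// -mexpE powRrM powR_mulrn ?(ltW ey)//.
have tt : th `^ (m + 1) * th `^ (- (m + 1)) = 1.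
  by rewrite powRN mulfV// gt_eqF// powR_gt0.
by rewrite mulrCA mulrA mulrA -(mulrA C) tt mulr1 [_ `^ (- _)]powRN.
Qed.

Lemma cvg_scaled_Phi y : y != 0 ->
  (k.+1%:R `^ (m + 1) * Phi s k.+1%:R y) @[k --> \oo] --> mom m / enorm y `^ (n%:R + 2
    * s).
Proof.
move=> y0; have ey : 0 < enorm y by rewrite lt_neqAle eq_sym enorm_eq0 y0 enorm_ge0.
have e2 : 0 < enorm y ^+ 2 by rewrite exprn_gt0.
pose q (k : nat) : R := k.+1%:R * enorm y ^+ 2.
have qoo : q k @[k --> \oo] --> +oo.
  apply/cvgryPge => A; near=> k; rewrite /q -ler_pdivrMr//.
  apply: (@le_trans _ _ k%:R); last by rewrite ler_nat.
  by near: k; exact: nbhs_infty_ger.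
have -> : (fun k : nat => k.+1%:R `^ (m + 1) * Phi s k.+1%:R y) =
    (fun k => q k `^ (m + 1) * Tk s m bump1 (q k) / enorm y `^ (n%:R + 2 * s)).
  apply/funext => k; rewrite /q powRM ?sqr_ge0// -mexpE.
  rewrite [enorm y `^ _]powRrM powR_mulrn ?(ltW ey)//.
  by rewrite mulrAC mulfK// gt_eqF// powR_gt0.
by apply: cvgM; [exact: cvg_Tk_bump1|exact: cvg_cst].
Unshelve. all: by end_near. Qed.

(** [Phi] is even, so u(x + y) and u(x - y) contribute the same convolution. *)
Lemma integral_Phi_second_diff th x : 0 < th ->
  (\int[mu]_y (Phi s th y * (2 * u x - u (x + y) - u (x - y)))%:E =
   (2 * (u x * (th `^ (- (n%:R / 2)) * fine (\int[mu]_y (Phi s 1 y)%:E)) - convol u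
     (Phi s th) x))%:E)%E.
Proof.
move=> th0; set P := Phi s th.
have mP : measurable_fun setT P := ker_measurable s01 m0 (@ker_Phi R n s th).
have c0 := convolE n2 s01 uLs x th0; rewrite -/P in c0.
have mu1 : measurable_fun setT (fun y => P y * u (x - y)).
  by apply: measurable_funM => //; exact: measurable_reflect.
have mu2 : measurable_fun setT (fun y => P y * u (x + y)).
  apply: measurable_funM => //.
  have := measurableT_comp mu_ (measurable_affine_rV 1 x).
  by rewrite (_ : u \o _ = fun y => u (x + y))//; apply/funext => y /=;
    rewrite scale1r addrC.
have E2 : (\int[mu]_y (P y * u (x + y))%:E)%E = (convol u P x)%:E.
  have mu2E : measurable_fun setT (fun y => (P y * u (x + y))%:E) by
    exact/measurable_EFinP.
  rewrite c0 -(integral_isometry_rV 0 _ mu2E (k := -1)) ?normrN1//.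
  apply: eq_integral => y _; rewrite addr0 scaleN1r.
  by rewrite /P /Phi enormN.
have M1 : (\int[mu]_y (Phi s 1 y)%:E)%E \is a fin_num.
  rewrite ge0_fin_numE; first exact: integral_Phi_lty.
  by apply: integral_ge0 => y _; rewrite lee_fin Phi_ge0.
have E0 : (\int[mu]_y (P y)%:E)%E = (th `^ (- (n%:R / 2)) * fine (\int[mu]_y (Phi s 1
  y)%:E)%E)%:E.
  by rewrite /P integral_Phi_scale// -{1}(fineK M1) EFinM.
have i0 : mu.-integrable setT (fun y => (P y)%:E).
  by apply: fin_num_integrable; [exact/measurable_EFinP|rewrite E0].
have i1 : mu.-integrable setT (fun y => (P y * u (x - y))%:E).
  by apply: fin_num_integrable; [exact/measurable_EFinP|rewrite -c0].
have i2 : mu.-integrable setT (fun y => (P y * u (x + y))%:E).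
  by apply: fin_num_integrable; [exact/measurable_EFinP|rewrite E2].
have i0' := integrableZl measurableT (2 * u x) i0.
transitivity (\int[mu]_y ((2 * u x)%:E * (P y)%:E - (P y * u (x + y))%:E - (P y * u (x
  - y))%:E))%E.
  by apply: eq_integral => y _; rewrite -EFinM -!EFinB; congr EFin; ring.
rewrite integralB//; last exact: integrableB.
rewrite integralB// integralZl// E0 E2 -c0 -EFinM -!EFinB; congr EFin.
by ring.
Qed.

Lemma mean_frac_laplacian (eps : R) x : small_eps s eps -> C2s_loc s eps u ->
  (exists2 d : R, 0 < d & forall r, 0 < r -> r < d -> (u x)%:E = A_star s r u x) ->
  frac_laplacian s u x = 0%E.
Proof.
move=> se uC [d d0 umean].
pose g y := 2 * u x - u (x + y) - u (x - y).
have ig := integrable_second_diff x se uC.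
set L := (\int[mu]_y ((2 * u x - u (x + y) - u (x - y)) / enorm y `^ (n%:R + 2 *
  s))%:E)%E in ig *.
have Lfin : L \is a fin_num by exact: integrable_fin_num ig.
suff L0 : L = 0%E by rewrite /frac_laplacian -/L L0 mule0.
have c0 := c_ns_gt0 n2 s01.
have c0' : c_ns n s != 0 by rewrite gt_eqF.
(* The second term in the parentheses is what the mean value property gives for the mass of
   [Phi 1]. *)
pose D := 2 * u x * (fine (\int[mu]_y (Phi s 1 y)%:E)%E - mom (m - s) / c_ns n s).
have mg : measurable_fun setT g := measurable_second_diff x.
have mPhi th := ker_measurable s01 m0 (@ker_Phi R n s th).
have mPg th : measurable_fun setT (fun y => (Phi s th y * g y)%:E).
  by apply/measurable_EFinP; exact: measurable_funM.
pose f (k : nat) y := k.+1%:R `^ (m + 1) * Phi s k.+1%:R y * g y.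
(* Only for large k are all radii below sqrt (2/th) admissible; the limit ignores the other
   indices. *)
have DE : \forall k \near \oo, (\int[mu]_y (f k y)%:E = (k.+1%:R `^ s * D)%:E)%E.
  near=> k; set th : R := k.+1%:R.
  have th0 : 0 < th by rewrite ltr0n.
  have thd : Num.sqrt (2 / th) < d.
    rewrite -[X in _ < X](ger0_norm (ltW d0)) -sqrtr_sqr ltr_sqrt ?exprn_gt0//.
    rewrite ltr_pdivrMr// -ltr_pdivrMl ?exprn_gt0// (@le_lt_trans _ _ k%:R) ?ltr_nat//.
    by near: k; exact: nbhs_infty_ger.
  have conv_eq := mean_convol n2 s01 uLs th0 (x := x)
    (fun r r0 rt => umean r r0 (lt_trans rt thd)).
  have H := integral_Phi_second_diff x th0.
  have iPg : mu.-integrable setT (fun y => (Phi s th y * g y)%:E).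
    by apply: fin_num_integrable => //; rewrite H.
  transitivity (\int[mu]_y ((th `^ (m + 1))%:E * (Phi s th y * g y)%:E))%E.
    by apply: eq_integral => y _; rewrite /f -EFinM mulrA.
  rewrite integralZl// H -EFinM; congr EFin.
  have -> : convol u (Phi s th) x = u x * (th `^ (- (n%:R / 2)) * mom (m - s)) / c_ns n
    s.
    by rewrite conv_eq mulrAC mulfV ?mul1r.
  (* The surplus m + 1 - n/2 equals s > 0; this growth is what the limit cannot tolerate unless [D]
     vanishes. *)
  have -> : th `^ s = th `^ (m + 1) * th `^ (- (n%:R / 2)).
    by rewrite -powRD ?(gt_eqF th0) ?implybT//; congr (_ `^ _); rewrite /mexp; ring.
  by rewrite /D; ring.
have cvL : (\int[mu]_y (f k y)%:E)%E @[k --> \oo] --> ((mom m)%:E * L)%E.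
  have [C C0 hC] := scaled_Phi_bound.
  rewrite -integralZl//.
  apply: (@dominated_cvg _ _ _ mu setT measurableT (fun k y => (f k y)%:E) _
    (fun y => C%:E * `|((2 * u x - u (x + y) - u (x - y)) / enorm y `^ (n%:R + 2 *
      s))%:E|)%E) => //.
  - move=> k; apply/measurable_EFinP; rewrite /f; apply: measurable_funM => //.
    by apply: measurable_funM => //; exact: mPhi.
  - move=> y _; rewrite -EFinM; apply: cvg_EFin; first exact: nearW.
    have [->|y0] := eqVneq y 0.
      have g0 : g 0 = 0 by rewrite /g addr0 subr0; ring.
      rewrite -/(g 0) g0 mul0r mulr0 (_ : fine \o _ = cst 0); first exact: cvg_cst.
      by apply/funext => k; rewrite /f /= g0 mulr0.
    have -> : mom m * ((2 * u x - u (x + y) - u (x - y)) / enorm y `^ (n%:R + 2 * s)) =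
       mom m / enorm y `^ (n%:R + 2 * s) * g y by rewrite /g; ring.
    by apply: cvgM; [exact: cvg_scaled_Phi|exact: cvg_cst].
  - exact: (integrableZl measurableT C (integrable_abse ig)).
  - move=> k y _; rewrite /= -EFinM lee_fin -/(g y).
    rewrite [X in _ <= _ * X]normrM normfV (ger0_norm (powR_ge0 _ _)).
    rewrite /f normrM mulrA mulrAC ler_wpM2r//.
    rewrite ger0_norm ?mulr_ge0 ?powR_ge0 ?Phi_ge0//.
    by apply: hC; rewrite ltr0n.
pose l := mom m * fine L.
have cvD : (k.+1%:R `^ s * D) @[k --> \oo] --> l.
  have lE : ((mom m)%:E * L)%E = l%:E by rewrite /l -{1}(fineK Lfin) -EFinM.
  rewrite lE in cvL.
  exact: (fine_cvg (cvg_trans (near_eq_cvg DE) cvL)).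
have D0 : D = 0.
  apply: contrapT => /eqP Dn0.
  have absD : 0 < `|D| by rewrite normr_gt0.
  (* Once (k + 1)^s exceeds this threshold, the sequence is at distance at least 1 from its limit
     [l]. *)
  pose X := (`|l| + 1) / `|D|.
  have X0 : 0 <= X by rewrite divr_ge0// addr_ge0.
  near \oo => k.
  have h1 : `|l - k.+1%:R `^ s * D| < 1.
    by near: k; move/cvgrPdist_lt : cvD; apply.
  have h2 : X <= k.+1%:R `^ s.
    apply: (@le_trans _ _ ((X `^ s^-1) `^ s)).
      by rewrite -powRrM mulVf ?gt_eqF// powRr1.
    apply: ge0_ler_powR; rewrite ?nnegrE ?powR_ge0 ?(ltW s0)//.
    apply: (@le_trans _ _ k%:R); last by rewrite ler_nat.
    by near: k; exact: nbhs_infty_ger.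
  have h3 : `|l| + 1 <= `|k.+1%:R `^ s * D|.
    by rewrite [X in _ <= X]normrM (ger0_norm (powR_ge0 _ _)) -ler_pdivrMr.
  have := ler_normD l (k.+1%:R `^ s * D - l); rewrite addrC subrK distrC.
  by move: h1 h3; lra.
have l0 : l = 0.
  have : (fun k : nat => k.+1%:R `^ s * D) @ \oo --> (0 : R).
    by rewrite D0; under eq_fun do rewrite mulr0; exact: cvg_cst.
  by move=> /(cvg_unique (@norm_hausdorff _ _) cvD).
have momn0 : mom m != 0 by rewrite gt_eqF// mom_gt0.
have : fine L = 0 by apply: (mulfI momn0); rewrite -/l l0 mulr0.
by move=> fL; rewrite -(fineK Lfin) fL.
Unshelve. all: by end_near. Qed.

(** A single th serves for all of [U], so [u] coincides there with one convolution, which is smooth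
    on the whole space. *)
Lemma mean_smooth (U : set 'rV[R]_n) (d : R) : open U -> 0 < d ->
  (forall x r, U x -> 0 < r -> r < d -> (u x)%:E = A_star s r u x) ->
  smooth_on U u.
Proof.
move=> oU d0 umean.
have c0 := c_ns_gt0 n2 s01.
(* The value for which sqrt (2/th) = d/2, so that every radius in the average is admissible. *)
pose th := 8 / d ^+ 2.
have th0 : 0 < th by rewrite divr_gt0// exprn_gt0.
have sqth : Num.sqrt (2 / th) = d / 2.
  have -> : 2 / th = (d / 2) ^+ 2 by rewrite /th; field; rewrite gt_eqF.
  by rewrite sqrtr_sqr ger0_norm// divr_ge0// ltW.
pose V := th `^ (- (n%:R / 2)) * mom (m - s).
have V0 : 0 < V by rewrite mulr_gt0 ?powR_gt0 ?mom_gt0.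
pose F y := c_ns n s / V * Phi s th y.
have kF : ker s m th 0 F by apply: kerZ; exact: ker_Phi.
apply: (@smooth_on_eq _ _ U u (convol u F)) => //; last first.
  by move=> l x _; exact: (smooth_convol s01 m0 th0 mu_ (Ls_weight uLs) kF).
move=> x Ux.
have E := mean_convol n2 s01 uLs th0 (x := x).
have : u x * V = c_ns n s * convol u (Phi s th) x.
  by apply: E => r r0 rd; apply: umean => //;
    rewrite (lt_trans rd)// sqth ltr_pdivrMr//; lra.
have V0' : V != 0 by rewrite gt_eqF.
move=> /(canRL (mulfK V0')) ->.
have iP := convol_integrable s01 m0 th0 mu_ (Ls_weight uLs) x (@ker_Phi R n s th).
rewrite {2}/convol /F; under eq_Rintegral do rewrite -mulrA.
by rewrite RintegralZl// mulrAC.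
Qed.

End final.

Theorem corollary15p8 (R : realType) (n : nat) (s : R)
  (Omega : set 'rV[R]_n) (u : 'rV[R]_n -> R)
  (n_ge2 : (2 <= n)%N) (s01 : 0 < s < 1)
  (openOmega : open Omega)
  (uLs : Ls s u)
  (uC : exists eps : R, small_eps s eps /\ C2s_loc s eps u)
  (umean : forall (x : 'rV[R]_n) (r : R), Omega x -> 0 < r ->
     (r%:E < edist_set x (boundary Omega))%E -> (u x)%:E = A_star s r u x) :
  (forall x : 'rV[R]_n, Omega x -> frac_laplacian s u x = 0%E) /\
  smooth_on Omega u.
Proof.
have [eps [se Ceps]] := uC.
split=> [x Ox|l x Ox]; have [d d0 hd] := dist_boundary openOmega Ox.
  apply: (mean_frac_laplacian n_ge2 s01 uLs se Ceps); exists d => // r r0 rd.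
  by apply: umean => //; apply: (hd x _).2; rewrite ?subrr ?normr0.
(* [smooth_on] is a condition at each point, so a ball with a uniform bound on the radii is
   enough. *)
apply: (@mean_smooth R n s n_ge2 s01 u uLs (ball x d) d _ d0) => //.
- exact: ball_open.
- move=> x' r; rewrite -ball_normE /= => xx' r0 rd; have [Ox' hx'] := hd x' xx'.
  by apply: umean => //; exact: hx'.
- exact: ballxx.
Qed.
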